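(* Let $\alpha,\beta$ be integers different from $1$ with $v_2(\alpha-1)=v_2(\beta-1)=m\ge 3$, and let $\ell=v_2(\alpha-\beta)$ satisfy $m<\ell<2m$, $\ell\le 2m-3$ and $2\ell+2\le 3m$. Then $|G_2|=2^{2m+3\ell}$, the nilpotency class of $G_2$ is $5$, $o(a)=o(b)=2^{\ell+m}$ and $o(c)=2^{2\ell-m+1}$.
   Context: $G(\alpha,\beta)=\langle A,B\mid A^{[A,B]}=A^{\alpha},\ B^{[B,A]}=B^{\beta}\rangle$ with $[x,y]=x^{-1}y^{-1}xy$, $y^x=x^{-1}yx$, and $C=[A,B]$. The group $G(\alpha,\beta)$ is finite and nilpotent, hence the direct product of its Sylow subgroups; $G_2$ denotes its Sylow $2$-subgroup and $a,b,c$ denote the images of $A,B,C$ under the canonical projection $G(\alpha,\beta)\to G_2$. $v_2$ is the $2$-adic valuation and $o(x)$ the order of $x$. *)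

(* Defs.v *)
From mathcomp Require Import all_boot all_order all_algebra all_fingroup all_solvable.
Set Implicit Arguments. Unset Strict Implicit. Unset Printing Implicit Defensive.
Local Open Scope group_scope.

Definition zpowg (gT : finGroupType) (x : gT) (z : int) : gT :=
  match z with Posz n => x ^+ n | Negz n => (x ^+ n.+1)^-1 end.

(* The defining relations of G(alpha,beta):
   A^[A,B] = A^alpha, B^[B,A] = B^beta.
   Paper: y^x = x^-1 y x and [x,y] = x^-1 y^-1 x y, which coincide with
   MathComp's  y ^ x  and  [~ x, y]. *)
Definition Grels (gT : finGroupType) (alpha beta : int) (x y : gT) : bool :=
  (x ^ [~ x, y] == zpowg x alpha) && (y ^ [~ y, x] == zpowg y beta).

(* (G, A, B) is (a copy of) G(alpha,beta) with its canonical generators: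
   G is generated by A and B, which satisfy the relations, and for every
   finite group H and elements x, y of H satisfying the relations there is a
   homomorphism G -> H sending A to x and B to y.  Since G(alpha,beta) is
   finite, this characterizes it (with A, B) up to isomorphism. *)
Definition is_Galphabeta (gT : finGroupType) (alpha beta : int)
    (G : {group gT}) (A B : gT) : Prop :=
  [/\ G :=: <[A]> <*> <[B]>, Grels alpha beta A B &
      forall (rT : finGroupType) (x y : rT), Grels alpha beta x y ->
        exists f : {morphism G >-> rT}, f A = x /\ f B = y].

Definition v2 (z : int) : nat := logn 2 `|z|%N.

(* Main.v *)
Require Import Defs.
From mathcomp Require Import all_boot all_order all_algebra all_fingroup all_solvable.
From mathcomp Require Import zify ring.
Local Open Scope group_scope.

(** Write C = [A, B], x = alpha - 1, y = beta - 1.  Computing A^(B^beta) in two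
    ways gives C^(x - y) = B^s A^t with v_2(s) = v_2(t) = 2m - 1; conjugating
    this by C, by A and by B bounds the orders of A, B and C.  The same
    computation with beta^i in place of beta, for all i, shows that every prime
    dividing o(A) divides alpha - 1, and this produces a non-trivial central
    element, so that G is nilpotent and its Sylow 2-subgroup P is generated by
    a and b.  With X = A^(2^m) and Y = B^(2^m), the upper central series
    of P passes through X^(2^(m-1)), C^(2^m), X, C and A, so the class is at
    most 5; the derived subgroup is the product of <X>, <Y> and <C>.
    The lower bounds reduce to one fact and its mirror image: no
    non-trivial power of a lies in <b>.  It is read off a permutation
    representation of G, which mimics the action of P on the cosets of <b>. *)

(** * Relations between powers of A, B and C *)

(** Exchanging A and B replaces C by C^-1 and swaps alpha with beta, so most lemmas treat A only and
    are applied twice. The constant 2m - 1 is the valuation of the sum of a^a - a^t over 1 <= t <=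
    a: modulo (a - 1)^2 this sum is (a - 1) a (a - 1) / 2, of valuation m + (m - 1). Once A and B
    are killed by 2^(l+m), raising C^(x - y) = B^s A^t to the power 2^(l-m+1) kills C, whence the
    exponent 2l - m + 1 = l + (l - m + 1). The bound 2l + 2 <= 3m is the inequality 2l - m + 1 <= 2m
    - 1: it makes C^(2^(2m-1)) trivial, and with it A^(2^(2m-1)) central. It returns as 4m - 2 - l
    >= l + m in the permutation model. The exponent 2m + 3l splits along the subgroup N generated by
    X, Y and C. The quotient P / N has order 2^(2m). Inside N, the product <X><Y> has order 2^(2l)
    and meets <C> in <C^(2^l)>, of order 2^(l-m+1), so that |N| = 2^(2l + (2l-m+1) - (l-m+1)) =
    2^(3l). *)

Fixpoint geo (a k : nat) : nat := if k is j.+1 then (a * (geo a j).+1)%N else 0%N.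

(* Equals the sum of a^k - a^t for 1 <= t <= k; by geo_le the subtraction does not truncate. *)
Definition geo_deficit (a k : nat) : nat := (k * a ^ k - geo a k)%N.

Lemma geo_le (a k : nat) : (0 < a)%N -> (geo a k <= k * a ^ k)%N.
Proof.
move=> a0; elim: k => //= k IH; rewrite expnS mulnCA leq_mul2l; apply/orP; right.
have h : (0 < a ^ k)%N by rewrite expn_gt0 a0.
by apply: leq_ltn_trans IH _; rewrite mulSn -[X in (X < _)%N]add0n ltn_add2r.
Qed.

Section Relations.
Variables (gT : finGroupType) (a : nat) (A B C : gT).
Hypothesis hC : A ^ B = A * C.
Hypothesis RA : A ^ C = A ^+ a.

Lemma rel_comm_sym : B ^ A = B * C^-1.
Proof.
apply: (mulgI (B * A)); rewrite -mulgA [RHS]mulgA -conjgC mulgA.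
have -> : B * A * B = B * (A * B) by rewrite mulgA.
by rewrite [A * B]conjgC hC !mulgA mulgK.
Qed.

Lemma rel_conjX (j n : nat) : (A ^+ j) ^ (C ^+ n) = A ^+ (j * a ^ n).
Proof.
elim: n => [|n IH]; first by rewrite expg0 conjg1 expn0 muln1.
by rewrite expgSr conjgM IH conjXg RA -expgM expnS mulnCA.
Qed.

Lemma rel_swap (j n : nat) : A ^+ j * C ^+ n = C ^+ n * A ^+ (j * a ^ n).
Proof. by rewrite -rel_conjX -conjgC. Qed.

(** Collecting the factors C of (A C)^k on the left turns the factors A into A^(a^k), ..., A^a;
    hence [geo a k] is a + a^2 + ... + a^k. *)
Lemma rel_pow_conjB (k : nat) : (A ^+ k) ^ B = C ^+ k * A ^+ (geo a k).
Proof.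
rewrite conjXg hC; elim: k => [|k IH] /=; first by rewrite !expg0 mulg1.
have := rel_swap (geo a k).+1 1; rewrite expn1 expg1 => e.
by rewrite [LHS]expgSr IH -mulgA [A ^+ _ * _]mulgA -expgSr e mulgA -expgSr mulnC.
Qed.

Lemma rel_comm_pow_conjA (n : nat) : (0 < a)%N ->
  (C ^+ n) ^ A = C ^+ n * (A ^+ (a ^ n).-1)^-1.
Proof.
move=> a0; have h : (0 < a ^ n)%N by rewrite expn_gt0 a0.
have := rel_swap 1 n; rewrite expg1 mul1n => e.
by apply: (mulgI A); rewrite conjgE mulKVg mulgA e -(prednK h) expgS -mulgA mulgK.
Qed.

End Relations.

(* Both sides come from A^(B^(b^i)): on the left B^(b^i) is replaced by C^i B C^-i,
   on the right (B^(b^i))^A is expanded. *)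
Lemma rel_key (gT : finGroupType) (a b : nat) (A B C : gT) (i : nat) :
  (0 < a)%N -> (0 < b)%N -> A ^ B = A * C -> A ^ C = A ^+ a -> B ^ C^-1 = B ^+ b ->
  C ^+ (a ^ i) =
  (B ^+ geo_deficit b (b ^ i)) ^ (C ^+ i) * C ^+ (b ^ i) * A ^+ geo_deficit a (a ^ i).
Proof.
move=> a0 b0 hC RA RB; set c := (a ^ i)%N; set k := (b ^ i)%N.
have hC' := rel_comm_sym _ _ _ _ hC.
have e1 : A ^ (B ^+ k) = (C ^+ c * A ^+ geo a c) ^ (C ^- i).
  rewrite -(rel_pow_conjB _ _ _ _ _ hC RA).
  have <- : A ^ (C ^+ i) = A ^+ c by have := rel_conjX _ _ _ _ RA 1 i; rewrite expg1 mul1n.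
  rewrite -!conjgM; have := rel_conjX _ _ _ _ RB 1 i; rewrite expg1 mul1n expgVn -/k => <-.
  by rewrite [B ^ _]conjgE invgK !mulgA.
have e2 : A ^ (B ^+ k) = A * B ^+ geo_deficit b k * C ^+ k.
  have := rel_pow_conjB _ _ _ _ _ hC' RB k; rewrite expgVn => h.
  have -> : A ^ (B ^+ k) = A * ((B ^+ k) ^ A)^-1 * B ^+ k by rewrite /conjg !invMg invgK !mulgA mulgV mul1g.
  rewrite h invMg invgK -!mulgA; congr (_ * _).
  have := rel_swap _ _ _ _ RB k k; rewrite expgVn => h2.
  have -> : C ^+ k * B ^+ k = B ^+ (k * b ^ k) * C ^+ k.
    by apply: (mulgI (C ^- k)); rewrite mulKg mulgA -h2 mulgKV.
  apply: (mulgI (B ^+ geo b k)); rewrite mulKVg [RHS]mulgA -expgD /geo_deficit subnKC //.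
  exact: geo_le.
have e3 : A ^+ c * (B ^+ geo_deficit b k) ^ (C ^+ i) * C ^+ k = C ^+ c * A ^+ geo a c.
  have h1 : A ^+ c = A ^ (C ^+ i) by have := rel_conjX _ _ _ _ RA 1 i; rewrite expg1 mul1n.
  have h2 : C ^+ k = (C ^+ k) ^ (C ^+ i) by rewrite conjgE -expgD addnC expgD mulKg.
  by rewrite {1}h1 {1}h2 -!conjMg -e2 e1 -conjgM mulVg conjg1.
have e4 := rel_swap _ _ _ _ RA c c.
apply: (mulgI (A ^+ c)); rewrite e4 mulgA [A ^+ c * _]mulgA e3 -mulgA -expgD /geo_deficit subnKC //.
exact: geo_le.
Qed.

(* Conjugating rel_key by C changes its two outer factors only, so a power of A
   equals a power of B; it is therefore central, and commutes with C. *)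
Lemma rel_key_central (gT : finGroupType) (a b : nat) (A B C : gT) (i : nat) :
  (0 < a)%N -> (0 < b)%N -> A ^ B = A * C -> A ^ C = A ^+ a -> B ^ C^-1 = B ^+ b ->
  let t := geo_deficit a (a ^ i) in
  A ^+ (a.-1 * t) \in <[B]> /\ A ^+ (a.-1 * (a.-1 * t)) = 1.
Proof.
move=> a0 b0 hC RA RB t; set c := (a ^ i)%N; set k := (b ^ i)%N.
have key := rel_key _ _ _ _ _ _ i a0 b0 hC RA RB.
have CB : C \in 'N(<[B]>).
  have : C^-1 \in 'N(<[B]>) by rewrite inE -cycleJ RB cycle_subG mem_cycle.
  by rewrite groupV.
have [u uB eu] : exists2 u, u \in <[B]> & C ^+ (a ^ i) = u * C ^+ (b ^ i) * A ^+ t.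
  exists ((B ^+ geo_deficit b (b ^ i)) ^ (C ^+ i)) => //.
  by rewrite memJ_norm ?groupX ?cycle_id // groupX.
have wE j : A ^+ (j * a) = A ^+ (a.-1 * j) * A ^+ j.
  by rewrite -expgD -mulSnr prednK // mulnC.
have h1 : A ^+ (a.-1 * t) \in <[B]>.
  have cC j : (C ^+ j) ^ C = C ^+ j by rewrite conjgE -expgSr expgS mulKg.
  have := cC (a ^ i)%N; rewrite {1}eu !conjMg cC.
  have := rel_conjX _ _ _ _ RA t 1; rewrite expn1 expg1 => ->.
  rewrite eu wE mulgA => /mulIg/(canRL (mulKg _)) ->.
  rewrite invMg -!mulgA [_ * (u * _)]mulgA -[C ^- _ * _]conjgE.
  by rewrite memJ_norm ?groupX // groupM // groupV memJ_norm.
split=> //; apply: (mulIg (A ^+ (a.-1 * t))); rewrite mul1g -wE.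
have := rel_conjX _ _ _ _ RA (a.-1 * t) 1; rewrite expn1 expg1 => <-.
have -> : C = A^-1 * A ^ B by rewrite hC mulKg.
have cB : commute (A ^+ (a.-1 * t)) B.
  by case/cycleP: h1 => j ->; apply/commute_sym/commuteX.
have cA : commute (A ^+ (a.-1 * t)) A by apply/commute_sym/commuteX.
apply/conjg_fixP/commgP; apply: commuteM; first exact: commuteV.
by rewrite /conjg; do 2?apply: commuteM => //; apply: commuteV.
Qed.

(** * Nilpotency *)

Lemma geo_pred (a k : nat) : (0 < a)%N -> (geo a k * a.-1 + a = a * a ^ k)%N.
Proof.
case: a => // a _; elim: k => [|k IH] /=; first by rewrite expn0; lia.
by rewrite expnS -IH /=; ring.
Qed.

Lemma totient_lt (d : nat) : (1 < d)%N -> (totient d < d)%N.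
Proof.
case: d => [|[|d]] // _; rewrite totient_count_coprime big_ltn //.
have -> : coprime d.+2 0 = false by rewrite /coprime gcdn0.
rewrite add0n; set s := (\sum_(_ <= _ < _) _)%N.
have : (s <= \sum_(1 <= i < d.+2) 1)%N by apply: leq_sum => i _; case: coprime.
by rewrite sum_nat_const_nat; lia.
Qed.

Section StepOne.
Import GRing.Theory.
Local Open Scope ring_scope.

(* If p does not divide a - 1, let d > 1 be the order of a modulo p, and choose
   i = totient d, so that a^i = 1 modulo d.  The hypothesis for this i reduces to
   a^i = 1 modulo p, whence d <= totient d. *)
Lemma prime_dvd_pred (p n a : nat) : prime p -> (p %| n)%N -> (0 < n)%N -> (0 < a)%N ->
  a ^ n = 1 %[mod n] ->
  (forall i, n %| a.-1 * (a.-1 * geo_deficit a (a ^ i)))%N -> (p %| a.-1)%N.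
Proof.
move=> pp pn n0 a0 an key; apply/negPn/negP => pa.
have chp := pchar_Fp pp.
have p1 := prime_gt1 pp.
have modE u v : (u = v %[mod p]) <-> (u%:R = v%:R :> 'F_p).
  by split=> [h|/(congr1 val)]; [apply: val_inj|]; rewrite /= !val_Fp_nat.
have anp : a ^ n = 1 %[mod p] by rewrite -(modn_dvdm (a ^ n) pn) an modn_dvdm.
have exd : exists d, (0 < d)%N && (a ^ d == 1 %[mod p]).
  by exists n; rewrite n0 anp eqxx.
case: (ex_minnP exd) => d /andP[d0 /eqP ad] dmin.
have d1 : (1 < d)%N.
  rewrite ltn_neqAle d0 andbT; apply/eqP => d1; case/negP: pa; move: ad.
  by rewrite -d1 expn1 => /eqP; rewrite eqn_mod_dvd // subn1.
have aq j : a ^ (d * j) = 1 %[mod p] by rewrite expnM -modnXm ad modnXm exp1n.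
have dn : (d %| n)%N.
  apply/negPn/negP => /negP ndn.
  have r0 : (0 < n %% d)%N by rewrite lt0n; apply/negP => h; apply: ndn.
  have : (d <= n %% d)%N.
    apply: dmin; rewrite r0 /= -{}anp {2}(divn_eq n d) [(_ %/ d * d)%N]mulnC expnD.
    by rewrite -modnMml aq modnMml mul1n.
  by rewrite leqNgt ltn_pmod.
have cad : coprime a d.
  have : coprime (a ^ n) n.
    by rewrite /coprime -gcdn_modl an gcdn_modl gcd1n.
  rewrite coprime_pexpl // => h; exact: coprime_dvdr dn h.
have ci := Euler_exp_totient cad; set i := totient d in ci; set c := (a ^ i)%N in ci.
have c0 : (0 < c)%N by rewrite expn_gt0 a0.
(* As c = a^i = 1 modulo d and a^d = 1 modulo p, the power a^c is a modulo p. *)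
have cd : (a ^ c)%:R = a%:R :> 'F_p.
  apply/modE; move/eqP: ci; rewrite eqn_mod_dvd // => /dvdnP[j hj].
  rewrite -(prednK c0) -subn1 hj mulnC.
  by rewrite expnS -modnMmr aq modnMmr muln1.
have predE : a.-1%:R = a%:R - 1 :> 'F_p by rewrite -{2}(prednK a0) -natr1 addrK.
have x1 : a%:R - 1 != 0 :> 'F_p by rewrite -predE -(dvdn_pcharf chp).
have x0 : a%:R != 0 :> 'F_p.
  apply/eqP => ax; have /modE := anp; rewrite natrX ax expr0n (gtn_eqF n0).
  by move/eqP; rewrite eq_sym oner_eq0.
have t0 : (geo_deficit a c)%:R = 0 :> 'F_p.
  apply/eqP; rewrite -(dvdn_pcharf chp); have := dvdn_trans pn (key i).
  by rewrite !Euclid_dvdM // !(negPf pa).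
(* Modulo p, the vanishing deficit reads [geo a c] = c a, while [geo a c] (a - 1) = a (a - 1) by
   [geo_pred]; cancelling a (a - 1) leaves c = 1. *)
move: t0; rewrite /geo_deficit natrB ?geo_le // natrM cd => /eqP; rewrite subr_eq0 => /eqP t0.
have := congr1 (fun n : nat => n%:R : 'F_p) (geo_pred a c a0).
rewrite natrD !natrM cd -t0 predE => e.
have e2 : (c%:R - 1) * (a%:R * (a%:R - 1)) = 0 :> 'F_p.
  have -> : (c%:R - 1) * (a%:R * (a%:R - 1)) = c%:R * a%:R * (a%:R - 1) + a%:R - a%:R * a%:R :> 'F_p by ring.
  by rewrite e subrr.
move/eqP: e2; rewrite !mulf_eq0 (negPf x0) (negPf x1) !orbF subr_eq0 => /eqP c1.
have : (d <= i)%N.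
  by apply: dmin; rewrite totient_gt0 d0; apply/eqP/modE.
by rewrite leqNgt totient_lt.
Qed.

End StepOne.

Lemma geoD (a i j : nat) : geo a (i + j) = (geo a i + a ^ i * geo a j)%N.
Proof. by elim: i => [|i IH] /=; rewrite ?expn0 ?mul1n // IH expnS; ring. Qed.

Lemma geoM (a k q : nat) : geo a (k * q) = (geo a k * \sum_(j < q) (a ^ k) ^ j)%N.
Proof.
elim: q => [|q IH]; first by rewrite big_ord0 !muln0.
by rewrite mulnSr geoD IH big_ord_recr /= -expnM; ring.
Qed.

Lemma expS_mod2 (z j : nat) : exists v, ((1 + z) ^ j = 1 + z * j + z * z * v)%N.
Proof.
elim: j => [|j [v IH]]; first by exists 0%N; rewrite expn0; lia.
by exists (j + v + z * v)%N; rewrite expnS IH -[j.+1]addn1; ring.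
Qed.

Lemma sum_expS_mod2 (z q : nat) :
  exists v, (\sum_(j < q) (1 + z) ^ j = q + z * 'C(q, 2) + z * z * v)%N.
Proof.
elim: q => [|q [v IH]]; first by exists 0%N; rewrite big_ord0 bin0n !muln0.
have [w e] := expS_mod2 z q.
by exists (v + w)%N; rewrite big_ord_recr /= IH e binS bin1 -[q.+1]addn1; ring.
Qed.

(** Modulo (b - 1)^2 the sum is q + (b - 1) C(q, 2). The error is a multiple of p q: if q differs
    from p, both divide b - 1; if q = p is odd, p also divides C(p, 2); for q = p = 2 the factor 4
    of b - 1 is required. *)
Lemma sum_exp_prime (p q b : nat) : prime p -> prime q -> (0 < b)%N ->
  (p %| b.-1)%N -> (q %| b.-1)%N -> (p = 2 -> 4 %| b.-1)%N ->
  exists u, (\sum_(j < q) b ^ j = q * (1 + p * u))%N.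
Proof.
move=> pp pq b0 pb qb p2.
have [v e] := sum_expS_mod2 b.-1 q; rewrite add1n prednK // in e.
suff /dvdnP[u hu] : (q * p %| b.-1 * 'C(q, 2) + b.-1 * b.-1 * v)%N.
  by exists u; rewrite e -addnA hu; ring.
have [qp|qp] := eqVneq q p; last first.
  have qpb : (q * p %| b.-1)%N by rewrite Gauss_dvd ?qb // prime_coprime // dvdn_prime2.
  by rewrite dvdn_add ?dvdn_mulr.
subst q; rewrite dvdn_add //; last by rewrite dvdn_mulr // dvdn_mul.
have [h2|p3] := eqVneq p 2; first by rewrite dvdn_mulr // h2; apply: p2.
by rewrite dvdn_mul // prime_dvd_bin //; have := prime_gt1 pp; lia.
Qed.

(** Prime factors q of k are split off one at a time: [geoM] contributes a sum of q powers, which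
    [sum_exp_prime] evaluates as q times a number congruent to 1 modulo p. The congruence to 1, not
    just equality of valuations, gives A^([geo a k]) = A^k when k p is the order of A. *)
Lemma geo_prime (p a k : nat) : prime p -> (0 < a)%N -> (p %| a.-1)%N ->
  (p = 2 -> 4 %| a.-1)%N -> (0 < k)%N ->
  (forall q, prime q -> q %| k -> q %| a.-1)%N ->
  exists u, (geo a k = k * (1 + p * u))%N.
Proof.
move=> pp a0 pa p2; elim: k {-2}k (leqnn k) => [|N IH] k kN k0 hk; first by lia.
have [k1|k1] := leqP k 1.
  have -> : k = 1%N by lia.
  by case/dvdnP: pa => u hu; exists u => /=; rewrite mul1n muln1 [(p * u)%N]mulnC -hu; lia.
have pq := pdiv_prime k1; set q := pdiv k in pq.
have ek : k = (k %/ q * q)%N by rewrite divnK ?pdiv_dvd.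
have k'0 : (0 < k %/ q)%N by rewrite divn_gt0 ?prime_gt0 // dvdn_leq ?pdiv_dvd.
have [u hu] : exists u, geo a (k %/ q) = (k %/ q * (1 + p * u))%N.
  apply: IH => //.
    by rewrite -ltnS; apply: leq_trans kN; rewrite ltn_Pdiv // prime_gt1.
  by move=> r pr rk; apply: hk => //; rewrite ek dvdn_mulr.
have dv r : (r %| a.-1 -> r %| (a ^ (k %/ q)).-1)%N.
  by move=> h; apply: dvdn_trans h (dvdn_pred_predX _ _).
have [v hv] : exists v, (\sum_(j < q) (a ^ (k %/ q)) ^ j = q * (1 + p * v))%N.
  apply: sum_exp_prime => //; first by rewrite expn_gt0 a0.
  - exact: dv.
  - by apply/dv/hk; rewrite ?pdiv_dvd.
  - by move=> h; apply/dv/p2.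
by exists (u + v + p * u * v)%N; rewrite [in LHS]ek geoM hu hv [in RHS]ek; ring.
Qed.

Section Half.
Variables (gT : finGroupType) (a : nat) (A B C : gT).
Hypothesis a0 : (0 < a)%N.
Hypothesis hC : A ^ B = A * C.
Hypothesis RA : A ^ C = A ^+ a.

(** Conjugating A^n = 1 by B, with n the order of A, makes C^n a power of A. It therefore
    centralises A, on which it acts as the power map a^n. *)
Lemma rel_order_exp : a ^ #[A] = 1 %[mod #[A]].
Proof.
apply/eqP; rewrite -eq_expg_mod_order expg1; apply/eqP.
have := rel_conjX _ _ _ _ RA 1 #[A]; rewrite expg1 mul1n => <-.
have := rel_pow_conjB _ _ _ _ _ hC RA #[A]; rewrite expg_order conj1g => h.
have -> : C ^+ #[A] = (A ^+ geo a #[A])^-1 by apply: (mulIg (A ^+ geo a #[A])); rewrite -h mulVg.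
by apply/conjg_fixP/commgP; apply: commuteV; apply: commuteX.
Qed.

Lemma rel_coprime : coprime a #[A].
Proof.
have : coprime (a ^ #[A]) #[A] by rewrite /coprime -gcdn_modl rel_order_exp gcdn_modl gcd1n.
by rewrite coprime_pexpl.
Qed.

(** A^k has order p, and [geo_prime] gives A^([geo a k]) = A^k. The p-th power of the first identity
    yields C^#[A] = 1, and a (a^k - 1) = [geo a k] (a - 1) is a multiple of k p, so C^k centralises
    A. The name refers to the mirror half for B. *)
Lemma rel_half (p : nat) : prime p -> (p %| #[A])%N ->
  (forall q, prime q -> q %| #[A] -> q %| a.-1)%N -> (p = 2 -> 4 %| a.-1)%N ->
  let k := (#[A] %/ p)%N in
  [/\ (A ^+ k) ^ B = C ^+ k * A ^+ k, C ^+ #[A] = 1, commute (C ^+ k) A & A ^+ k != 1].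
Proof.
move=> pp pA hq p2 k.
have ekp : #[A] = (k * p)%N by rewrite divnK.
have k0 : (0 < k)%N by have := order_gt0 A; rewrite ekp; case: (k).
have pa := hq p pp pA.
have [u hu] : exists u, geo a k = (k * (1 + p * u))%N.
  by apply: geo_prime => // q pq qk; apply: hq => //; rewrite ekp dvdn_mulr.
have AB : (A ^+ k) ^ B = C ^+ k * A ^+ k.
  by rewrite (rel_pow_conjB _ _ _ _ _ hC RA) hu mulnDr muln1 expgD mulnA -ekp expgM expg_order expg1n mulg1.
have AC : commute (A ^+ k) C.
  apply/commgP/conjg_fixP; have := rel_conjX _ _ _ _ RA k 1; rewrite expg1 expn1 => ->.
  apply/eqP; rewrite eq_expg_mod_order eqn_mod_dvd ?leq_pmulr // ekp.
  have -> : (k * a - k = k * a.-1)%N by rewrite -subn1 mulnBr muln1.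
  by rewrite dvdn_mul.
split=> //.
- have : ((A ^+ k) ^ B) ^+ p = 1 by rewrite -conjXg -expgM -ekp expg_order conj1g.
  by rewrite AB expgMn; [rewrite -!expgM -ekp expg_order mulg1 | apply/commute_sym/commuteX].
- apply/commute_sym/commgP/conjg_fixP; have := rel_conjX _ _ _ _ RA 1 k; rewrite expg1 mul1n => ->.
  have ak0 : (0 < a ^ k)%N by rewrite expn_gt0 a0.
  apply/eqP; rewrite -{2}[A]expg1 eq_expg_mod_order eqn_mod_dvd // subn1.
  rewrite -(@Gauss_dvdr _ a) 1?coprime_sym ?rel_coprime //.
  have -> : (a * (a ^ k).-1 = geo a k * a.-1)%N.
    by rewrite -[(a ^ k).-1]subn1 mulnBr muln1 -(geo_pred a k a0) addnK.
  by rewrite ekp hu mulnAC dvdn_mulr // dvdn_mul.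
- by rewrite -order_dvdn gtnNdvd // ekp -{1}[k]muln1 ltn_mul2l k0 prime_gt1.
Qed.

End Half.

Lemma rel_prime_dvd (gT : finGroupType) (a b : nat) (A B C : gT) (p : nat) :
  (0 < a)%N -> (0 < b)%N -> A ^ B = A * C -> A ^ C = A ^+ a -> B ^ C^-1 = B ^+ b ->
  prime p -> (p %| #[A])%N -> (p %| a.-1)%N.
Proof.
move=> a0 b0 hC RA RB pp pA; apply: (prime_dvd_pred p #[A]) => //.
  exact: rel_order_exp _ _ _ _ _ hC RA.
move=> i; rewrite order_dvdn; apply/eqP.
by case: (rel_key_central _ _ _ _ _ _ i a0 b0 hC RA RB).
Qed.

(** With k = #[A] / p, the element A^k is central as soon as C^k = 1. Otherwise C^k has order p,
    which forces p to divide #[B], and with k' = #[B] / p either B^k' is central or C^k' also has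
    order p. In the last case C^k and C^k' generate the same subgroup of the cyclic group <C>; one
    centralises A, the other B, so C^k is central. *)
Lemma rel_center_nontriv (gT : finGroupType) (a b : nat) (A B C : gT) :
  (0 < a)%N -> (0 < b)%N -> A ^ B = A * C -> A ^ C = A ^+ a -> B ^ C^-1 = B ^+ b ->
  (4 %| a.-1)%N -> (4 %| b.-1)%N -> <[A]> <*> <[B]> != 1 ->
  exists z, [/\ z \in <[A]> <*> <[B]>, z != 1, commute z A & commute z B].
Proof.
move=> a0 b0 hC RA RB a4 b4 G1.
have hC' := rel_comm_sym _ _ _ _ hC.
have pa p : prime p -> (p %| #[A])%N -> (p %| a.-1)%N by exact: rel_prime_dvd hC RA RB.
have pb p : prime p -> (p %| #[B])%N -> (p %| b.-1)%N.
  have RA' : A ^ C^-1^-1 = A ^+ a by rewrite invgK.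
  exact: rel_prime_dvd hC' RB RA'.
have AG j : A ^+ j \in <[A]> <*> <[B]> by rewrite groupX // mem_gen // inE cycle_id.
have BG j : B ^+ j \in <[A]> <*> <[B]> by rewrite groupX // mem_gen // inE cycle_id orbT.
have [A1|A1] := eqVneq A 1.
  exists B; split=> //; first by rewrite -[B]expg1.
    by apply/eqP => B1; case/eqP: G1; apply/trivgP; rewrite join_subG A1 B1 !cycle1 !subxx.
  by rewrite A1; apply: commute1.
have [B1|B1] := eqVneq B 1.
  exists A; split=> //; first by rewrite -[A]expg1.
  by rewrite B1; apply: commute1.
have pr (x : gT) : x != 1 -> prime (pdiv #[x]) by move=> x1; rewrite pdiv_prime // order_gt1.
have [AB CnA CA A0] := rel_half _ _ _ _ _ a0 hC RA _ (pr A A1) (pdiv_dvd _) pa (fun _ => a4).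
set p := pdiv _ in AB CA A0; set k := (#[A] %/ p)%N in AB CA A0.
have pp : prime p := pr A A1.
have [Ck1|Ck1] := eqVneq (C ^+ k) 1.
  exists (A ^+ k); split=> //; first exact/commute_sym/commuteX.
  by apply/commgP/conjg_fixP; rewrite AB Ck1 mul1g.
have [_ CnB _ _] := rel_half _ _ _ _ _ b0 hC' RB _ (pr B B1) (pdiv_dvd _) pb (fun _ => b4).
have oCk : #[C ^+ k] = p.
  by apply: nt_prime_order => //; rewrite -expgM divnK ?pdiv_dvd.
have pB : (p %| #[B])%N.
  rewrite -oCk; apply: dvdn_trans (orderXdvd _ _) _.
  by rewrite order_dvdn -[C]invgK expgVn CnB invg1.
have [BA _ CB B0] := rel_half _ _ _ _ _ b0 hC' RB _ pp pB pb (fun _ => b4).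
set k' := (#[B] %/ p)%N in BA CB B0; rewrite expgVn in BA CB.
have [Ck1'|Ck1'] := eqVneq (C ^+ k') 1.
  exists (B ^+ k'); split=> //; last exact/commute_sym/commuteX.
  by apply/commgP/conjg_fixP; rewrite BA Ck1' invg1 mul1g.
have oCk' : #[C ^+ k'] = p.
  by apply: nt_prime_order => //; rewrite -expgM divnK // -[C]invgK expgVn CnB invg1.
exists (C ^+ k); split=> //.
  rewrite groupX //; have -> : C = A^-1 * A ^ B by rewrite hC mulKg.
  by have := AG 1%N; have := BG 1%N; rewrite !expg1 => ? ?; rewrite groupM ?groupV ?groupJ.
have /cycleP[j ->] : C ^+ k \in <[C ^+ k']>.
  have /eqP <- : <[C ^+ k]>%G :==: <[C ^+ k']>%G; last exact: cycle_id.
  by rewrite (eq_subG_cyclic (cycle_cyclic C)) ?cycle_subG ?mem_cycle // -!orderE oCk oCk'.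
by apply/commute_sym/commuteX; rewrite -[C ^+ k']invgK; apply/commuteV/commute_sym.
Qed.

(** The hypotheses pass to the quotient by the centre, so induction on the order applies. This is
    why nothing so far involves the universal property, which a quotient would lose. *)
Lemma rel_nilpotent (gT : finGroupType) (a b : nat) (G : {group gT}) (A B C : gT) :
  (0 < a)%N -> (0 < b)%N -> (4 %| a.-1)%N -> (4 %| b.-1)%N ->
  G :=: <[A]> <*> <[B]> ->
  A ^ B = A * C -> A ^ C = A ^+ a -> B ^ C^-1 = B ^+ b -> nilpotent G.
Proof.
move=> a0 b0 a4 b4; have [N leN] := ubnP #|G|.
elim: N => // N IH in gT G A B C leN *; move=> defG hC RA RB.
have [G1|G1] := eqVneq (G : {set gT}) 1; first by rewrite G1 nilpotent1.
have [|z [zG z1 zA zB]] := rel_center_nontriv _ _ _ _ _ _ a0 b0 hC RA RB a4 b4; first by rewrite -defG.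
have AG : A \in G by rewrite defG mem_gen // inE cycle_id.
have BG : B \in G by rewrite defG mem_gen // inE cycle_id orbT.
have CE : C = A^-1 * A ^ B by rewrite hC mulKg.
have CG : C \in G by rewrite CE groupM ?groupV ?groupJ.
have zZ : z \in 'Z(G).
  rewrite -defG in zG; rewrite inE zG -sub_cent1 defG join_subG !cycle_subG.
  by apply/and3P; split=> //; apply/cent1P/commute_sym.
rewrite -quotient_center_nil.
have nZ := normal_norm (center_normal G).
have [AN BN CN] : [/\ A \in 'N('Z(G)), B \in 'N('Z(G)) & C \in 'N('Z(G))].
  by split; apply: (subsetP nZ).
apply: (IH _ _ (coset 'Z(G) A) (coset 'Z(G) B) (coset 'Z(G) C)).
- have Z1 : 'Z(G) != 1 by apply: contraNneq z1 => Z1; rewrite Z1 inE in zZ.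
  by rewrite -ltnS; apply: leq_trans leN; rewrite ltnS ltn_quotient ?center_sub.
- have e : G / 'Z(G) = <[coset 'Z(G) A]> <*> <[coset 'Z(G) B]>.
    by rewrite -!quotient_cycle // -quotientY ?cycle_subG // -defG.
  exact: e.
- by rewrite -morphJ // hC morphM.
- by rewrite -morphJ // RA morphX.
- by rewrite -morphV // -morphJ ?groupV // RB morphX.
Qed.

(** * Two-adic valuations of geometric sums *)

Lemma geo_double (a k : nat) : geo a k.*2 = (geo a k * (1 + a ^ k))%N.
Proof. by rewrite -addnn geoD; ring. Qed.

(** Induction on e by doubling k. The error of [geo] is governed by (a - 1) k (k + 1) / 2, whose
    denominator costs one factor 2; hence a - 1 is taken divisible by 2^(m+1), and later uses
    instantiate m with [m.-1]. *)
Lemma geo_mod2 (m a e k : nat) : (0 < a)%N -> (2 ^ m.+1 %| a.-1)%N -> (2 ^ e %| k)%N ->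
  (exists u, geo a k = k + 2 ^ (m + e) * u)%N /\ (exists v, a ^ k = 1 + 2 ^ (m.+1 + e) * v)%N.
Proof.
move=> a0 ma; elim: e k => [|e IH] k.
  move=> _; rewrite !addn0; split; last first.
    have ak0 : (0 < a ^ k)%N by rewrite expn_gt0 a0.
    have /dvdnP[v hv] := dvdn_trans ma (dvdn_pred_predX a k).
    by exists v; rewrite mulnC -hv add1n prednK.
  case/dvdnP: ma => w hw; have aE : a = (1 + 2 ^ m * (2 * w))%N.
    by rewrite -(prednK a0) hw expnS; ring.
  elim: k => [|k [u IH]]; first by exists 0%N; rewrite muln0.
  exists (u + 2 * w * (k + 1 + 2 ^ m * u))%N.
  by rewrite [LHS]/= IH {1}aE -[k.+1]addn1 -[(_ + _).+1]addn1; ring.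
rewrite expnS => /dvdnP[j hj]; have [|[u hu] [v hv]] := IH (2 ^ e * j)%N; first exact: dvdn_mulr.
have -> : k = (2 ^ e * j).*2 by rewrite hj -mul2n; ring.
split.
  exists (u + 2 ^ e * j * v + 2 ^ (m + e) * u * v)%N.
  by rewrite geo_double hu hv addnS addSn !expnS expnD -mul2n; ring.
exists (v + 2 ^ (m + e) * v * v)%N.
by rewrite -mul2n [(2 * _)%N]mulnC expnM hv addnS addSn !expnS; ring.
Qed.

Lemma expn_pred_dvd (m a e k : nat) : (0 < m)%N -> (0 < a)%N -> (2 ^ m %| a.-1)%N ->
  (2 ^ e %| k)%N -> (2 ^ (m + e) %| (a ^ k).-1)%N.
Proof.
case: m => // m _ a0 ma ke; have [_ [v ->]] := geo_mod2 m a e k a0 ma ke.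
by rewrite add1n dvdn_mulr.
Qed.

(** Lifting the exponent at 2: in a (a^K - 1) = [geo a K] (a - 1) with K = 2^e k, the factor
    [geo a K] is 2^e times an odd number. *)
Lemma expn_pred_odd (m a e k x : nat) : (1 < m)%N -> (0 < a)%N -> odd x -> odd k ->
  (a.-1 = 2 ^ m * x)%N -> exists2 w, odd w & ((a ^ (2 ^ e * k)).-1 = 2 ^ (m + e) * w)%N.
Proof.
case: m => [|[|m]] // _ a0 ox ok ax; set K := (2 ^ e * k)%N.
have [|[u hu] _] := geo_mod2 m.+1 a e K a0 _ (dvdn_mulr _ (dvdnn _)).
  by rewrite ax dvdn_mulr.
have aK0 : (0 < a ^ K)%N by rewrite expn_gt0 a0.
have oa : odd a by rewrite -(prednK a0) ax /= oddM oddX.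
have e1 : (a * (a ^ K).-1 = 2 ^ (m.+2 + e) * (x * (k + 2 * (2 ^ m * u))))%N.
  have -> : (a * (a ^ K).-1 = geo a K * a.-1)%N.
    by rewrite -[(a ^ K).-1]subn1 mulnBr muln1 -(geo_pred a K a0) addnK.
  by rewrite hu ax /K !expnD !expnS; ring.
have /dvdnP[w hw] : (2 ^ (m.+2 + e) %| (a ^ K).-1)%N.
  have cpa : coprime (2 ^ (m.+2 + e)) a by rewrite coprimeXl // coprime2n.
  by rewrite -(Gauss_dvdr _ cpa) e1 dvdn_mulr.
exists w; last by rewrite hw mulnC.
move: e1; rewrite hw mulnA mulnC => /eqP; rewrite eqn_pmul2l ?expn_gt0 // => /eqP/(congr1 odd).
by rewrite !oddM oddD oddM ox ok /= => /andP[].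
Qed.

Lemma geo_deficit_dvd (m a e k : nat) : (0 < a)%N -> (2 ^ m.+1 %| a.-1)%N -> (2 ^ e %| k)%N ->
  (2 ^ (m + e) %| geo_deficit a k)%N.
Proof.
move=> a0 ma ke; have [[u hu] [v hv]] := geo_mod2 m a e k a0 ma ke.
rewrite /geo_deficit hu hv mulnDr muln1 subnDl dvdn_sub //; last exact: dvdn_mulr.
by rewrite dvdn_mull // dvdn_mulr // dvdn_exp2l // leq_add2r.
Qed.

(** Modulo (a - 1)^2 the difference a^k - a^t is (k - t) (a - 1), and the numbers k - t add up to
    C(k, 2). *)
Lemma geo_deficit_quadratic (a k : nat) : (0 < a)%N ->
  exists v, (geo_deficit a k = a.-1 * 'C(k, 2) + a.-1 ^ 2 * v)%N.
Proof.
move=> a0; elim: k => [|k [v IH]]; first by exists 0%N; rewrite /geo_deficit bin0n !muln0.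
have [w hw] := expS_mod2 a.-1 k; rewrite add1n prednK // in hw.
have gS : geo_deficit a k.+1 = (a * (geo_deficit a k + (a ^ k).-1))%N.
  have := geo_le a k a0; rewrite /geo_deficit /= expnS mulSn.
  have ak0 : (0 < a ^ k)%N by rewrite expn_gt0 a0.
  have -> : (a * a ^ k + k * (a * a ^ k) = a * (a ^ k + k * a ^ k))%N by ring.
  by move=> h; rewrite -mulnBr; congr (_ * _)%N; lia.
have aE : a = (1 + a.-1)%N by rewrite add1n prednK.
have hw' : ((a ^ k).-1 = a.-1 * k + a.-1 * a.-1 * w)%N by rewrite hw -addnA add1n.
exists (v + w + 'C(k, 2) + k + a.-1 * v + a.-1 * w)%N.
rewrite gS IH hw' {1}aE binS bin1 expnS expn1; ring.
Qed.

(** The leading term (a - 1) C(a, 2) has valuation m + (m - 1), and the remainder is divisible by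
    2^(2m). *)
Lemma geo_deficit_odd (m a x : nat) : (1 < m)%N -> (0 < a)%N -> odd x -> (a.-1 = 2 ^ m * x)%N ->
  exists2 w, odd w & (geo_deficit a a = 2 ^ (2 * m - 1) * w)%N.
Proof.
move=> m1 a0 ox ax; have [v ->] := geo_deficit_quadratic a a a0.
have m2 : (2 ^ m = 2 * 2 ^ (m - 1))%N by rewrite -expnS subn1 prednK // ltnW.
have hb : ('C(a, 2) = 2 ^ (m - 1) * (x * a))%N.
  have := mul_bin_diag a 1; rewrite bin1 ax m2 => h.
  by apply/eqP; rewrite -(eqn_pmul2l (isT : 0 < 2)%N) -h; apply/eqP; ring.
have oa : odd a by rewrite -(prednK a0) ax /= oddM oddX; case: (m) m1.
exists (x * (x * a) + 2 * (x ^ 2 * v))%N; first by rewrite oddD !oddM ox oa.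
rewrite hb ax (_ : (2 * m - 1 = m + (m - 1))%N); last by lia.
by rewrite expnD m2; ring.
Qed.

(** * Exponents of the generators of a 2-group *)

Lemma two_elt_odd_inv (gT : finGroupType) (x : gT) (d : nat) : 2.-elt x -> odd d ->
  exists2 e, odd e & x ^+ (d * e) = x.
Proof.
move=> x2 od; have [e1] := p_natP x2 => ox.
have cd : coprime d #[x] by rewrite ox coprimeXr // coprimen2.
exists (d ^ (totient #[x]).-1)%N; first by rewrite oddX od orbT.
rewrite -expnS prednK ?totient_gt0 ?order_gt0 //.
by apply/eqP; rewrite -{3}[x]expg1 eq_expg_mod_order Euler_exp_totient.
Qed.

Lemma two_elt_exp_odd (gT : finGroupType) (x : gT) (k d : nat) : 2.-elt x -> odd d ->
  x ^+ (k * d) = 1 -> x ^+ k = 1.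
Proof.
move=> x2 od h; have x2k : 2.-elt (x ^+ k) by apply: p_eltX.
by have [e _ <-] := two_elt_odd_inv _ _ d x2k od; rewrite -expgM mulnA expgM h expg1n.
Qed.

Lemma two_elt_dvd1 (gT : finGroupType) (x : gT) (j k d : nat) : 2.-elt x -> odd d ->
  x ^+ (2 ^ j * d) = 1 -> (2 ^ j %| k)%N -> x ^+ k = 1.
Proof.
by move=> x2 od /(two_elt_exp_odd _ _ _ _ x2 od) h /dvdnP[i ->]; rewrite mulnC expgM h expg1n.
Qed.

Lemma two_elt_odd_mem (gT : finGroupType) (H : {group gT}) (x : gT) (d : nat) :
  2.-elt x -> odd d -> x ^+ d \in H -> x \in H.
Proof. by move=> x2 od h; have [e _ <-] := two_elt_odd_inv _ x d x2 od; rewrite expgM groupX. Qed.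

(** The data satisfied by the 2-parts of A, B and C, in a form stable under the mirror symmetry. The
    exponents are natural representatives of alpha and beta, so a - b = 2^l d holds only as a
    congruence; [tr_d] states it as an equality of powers of C. *)
Record two_rel (gT : finGroupType) (a b m l : nat) (A B C : gT) : Prop := TwoRel {
  tr_a0 : (0 < a)%N;
  tr_b0 : (0 < b)%N;
  tr_m : (1 < m)%N;
  tr_ml : (m < l)%N;
  tr_lm : (2 * l + 2 <= 3 * m)%N;
  tr_a : exists2 x, odd x & a.-1 = (2 ^ m * x)%N;
  tr_b : exists2 y, odd y & b.-1 = (2 ^ m * y)%N;
  tr_C : A ^ B = A * C;
  tr_RA : A ^ C = A ^+ a;
  tr_RB : B ^ C^-1 = B ^+ b;
  tr_d : exists2 d, odd d & C ^+ a = C ^+ (b + 2 ^ l * d);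
  tr_A2 : 2.-elt A;
  tr_B2 : 2.-elt B;
  tr_C2 : 2.-elt C
}.

Lemma two_rel_sym (gT : finGroupType) (a b m l : nat) (A B C : gT) :
  two_rel gT a b m l A B C -> two_rel gT b a m l B A C^-1.
Proof.
case=> a0 b0 m1 ml lm ha hb hC RA RB [d od hd] A2 B2 C2; split=> //.
- exact: rel_comm_sym hC.
- by rewrite invgK.
(* The number k = 2 #[C] - 1 is an odd natural stand-in for -1 in exponents of C. *)
- have [k hk] : exists k, (2 * #[C] = k.+1)%N.
    by exists (2 * #[C]).-1%N; rewrite prednK // muln_gt0 order_gt0.
  exists (d * k)%N; first by rewrite oddM od; have := congr1 odd hk; rewrite oddM /=; case: odd.
  rewrite !expgVn expgD hd -expgD; congr (_^-1).
  have -> : (b + 2 ^ l * d + 2 ^ l * (d * k) = b + #[C] * (2 * (2 ^ l * d)))%N.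
    have -> : (#[C] * (2 * (2 ^ l * d)) = k.+1 * (2 ^ l * d))%N by rewrite -hk; ring.
    by rewrite -[k.+1]addn1; ring.
  by rewrite expgD expgM expg_order expg1n mulg1.
- by rewrite p_eltV.
Qed.

Section TwoGroup.
Variables (gT : finGroupType) (a b m l : nat) (A B C : gT).
Hypothesis H : two_rel gT a b m l A B C.

Lemma two_rel_inv : exists2 b', odd b' & B ^ C = B ^+ b'.
Proof.
case: H => _ b0 m2 _ _ _ [y _ hy] _ _ RB _ _ _ _.
have ob : odd b by rewrite -(prednK b0) hy /= oddM oddX; case: (m) m2.
exists (b ^ #[C].-1)%N; first by rewrite oddX ob orbT.
have := rel_conjX _ _ _ _ RB 1 #[C].-1; rewrite expg1 mul1n expgVn => <-; congr (_ ^ _).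
by apply: (mulIg (C ^+ #[C].-1)); rewrite mulVg -expgS prednK ?order_gt0 // expg_order.
Qed.

Lemma two_key : exists d s t, [/\ odd d, odd s, odd t &
  C ^+ (2 ^ l * d) = B ^+ (2 ^ (2 * m - 1) * s) * A ^+ (2 ^ (2 * m - 1) * t)].
Proof.
have [b' ob' RB'] := two_rel_inv.
case: H => a0 b0 m2 _ _ [x ox ax] [y oy hy] hC RA RB [d od hd] _ _ _.
have := rel_key _ _ _ _ _ _ 1 a0 b0 hC RA RB; rewrite !expn1 expg1.
have [t ot ->] := geo_deficit_odd m a x m2 a0 ox ax; have [s os ->] := geo_deficit_odd m b y m2 b0 oy hy.
have := rel_conjX _ _ _ _ RB' (2 ^ (2 * m - 1) * s) 1; rewrite expg1 expn1 => ->.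
rewrite (rel_swap _ _ _ _ RB') hd expgD -mulgA => /mulgI h.
by exists d, (s * b' ^ b.+1)%N, t; split=> //; rewrite ?oddM ?oddX ?os ?ob' // h expnS !mulnA.
Qed.

(** A crude first bound, 4m - 1 = 2m + (2m - 1), from A^((a-1)^2 t) = 1. It suffices to show that
    the two factors of [two_key] commute. *)
Lemma two_A_exponent : A ^+ (2 ^ (4 * m - 1)) = 1.
Proof.
case: H => a0 b0 m2 _ _ [x ox ax] _ hC RA RB _ A2 _ _.
have [_] := rel_key_central _ _ _ _ _ _ 1 a0 b0 hC RA RB; rewrite expn1.
have [t ot ->] := geo_deficit_odd m a x m2 a0 ox ax; rewrite ax.
have -> : (2 ^ m * x * (2 ^ m * x * (2 ^ (2 * m - 1) * t)) =
           2 ^ (4 * m - 1) * (x * x * t))%N.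
  have -> : (4 * m - 1 = m + m + (2 * m - 1))%N by lia.
  by rewrite !expnD; ring.
by apply: two_elt_exp_odd; rewrite // !oddM ox ot.
Qed.

(* Conjugating C^(2^l d) = B^S A^T by A gives A^N = B^g C^S with v_2(N) = l + m;
   here C^S is a power of C^(2^l d), hence a product of powers of A and B.
   Its exponents have valuation 4m - 2 - l, which equals l + m exactly when
   2l + 2 = 3m: this is where the two cases come from. *)
Lemma two_half_bound :
  ((2 * l + 2 < 3 * m)%N -> A ^+ (2 ^ (l + m)) \in <[B ^+ (2 ^ (l + m).+1)]>) /\
  ((2 * l + 2 = 3 * m)%N -> B ^+ (2 ^ (l + m)) \in <[A ^+ (2 ^ (l + m).+1)]>).
Proof.
have [d [s [t [od os ot D]]]] := two_key.
case: H => a0 b0 m2 ml lm [x ox ax] [y _ bx] hC RA RB _ A2 B2 C2.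
have E1 : (4 * m - 2 - l = l + m + (3 * m - 2 * l - 2))%N by clear -ml lm; lia.
have E2 : (2 * l + 2 < 3 * m)%N -> exists j, (3 * m - 2 * l - 2 = j.+1)%N.
  by move=> h; exists (3 * m - 2 * l - 3)%N; clear -h; lia.
have E3 : (2 * l + 2 = 3 * m -> 4 * m - 2 - l = l + m)%N by clear; lia.
have [q1 hq1] : exists q1, (2 * m - 1 = l + q1)%N.
  by exists (2 * m - 1 - l)%N; clear -ml lm; lia.
have E4 : (4 * m - 2 - l = (2 * m - 1) + q1)%N by clear -hq1 ml lm; lia.
have E5 : (m.-1 + (2 * m - 1) = (l + m).+1 + (3 * m - 2 - (l + m).+1))%N by clear -ml lm m2; lia.
have E6 : (4 * m - 1 <= 2 * m - 1 + (m + l))%N by clear -ml m2; lia.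
set S := (2 ^ (2 * m - 1) * s)%N in D; set T := (2 ^ (2 * m - 1) * t)%N in D.
have [e oe hCe] := two_elt_odd_inv _ _ _ C2 od.
have [N oN hN] := expn_pred_odd m a l d x m2 a0 ox od ax.
have cST : commute (B ^+ S) (A ^+ T).
  have cDT : commute (C ^+ (2 ^ l * d)) (A ^+ T).
    apply/commute_sym/commgP/conjg_fixP; rewrite (rel_conjX _ _ _ _ RA).
    have aP : (0 < a ^ (2 ^ l * d))%N by rewrite expn_gt0 a0.
    rewrite -(prednK aP) hN mulnS expgD -[RHS]mulg1; congr (_ * _).
    apply: (two_elt_dvd1 _ _ (4 * m - 1) _ 1) => //; first by rewrite muln1 two_A_exponent.
    by rewrite /T mulnACA -expnD dvdn_mulr // dvdn_exp2l ?E6.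
  have -> : B ^+ S = C ^+ (2 ^ l * d) * (A ^+ T)^-1 by rewrite D mulgK.
  by apply: commute_sym; apply: commuteM; [exact: commute_sym | apply: commuteV].
have hC' := rel_comm_sym _ _ _ _ hC.
have e1 : A ^+ (2 ^ (m + l) * N) = B ^+ geo_deficit b S * C ^+ S.
  have := rel_comm_pow_conjA _ _ _ _ RA (2 ^ l * d) a0; rewrite hN D conjMg.
  rewrite (rel_pow_conjB _ _ _ _ _ hC' RB) [(A ^+ _) ^ A]conjgE -expgSr expgS mulKg.
  have -> : B ^+ S * A ^+ T * (A ^+ (2 ^ (m + l) * N))^-1 =
            B ^+ S * (A ^+ (2 ^ (m + l) * N))^-1 * A ^+ T.
    by rewrite -!mulgA; congr (_ * _); apply/commuteV/commuteX2.
  move/mulIg => h.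
  have -> : A ^+ (2 ^ (m + l) * N) = (B ^+ geo b S)^-1 * C ^+ S * B ^+ S.
    by apply: invg_inj; rewrite !invMg invgK -[C ^- S]expgVn h mulKg.
  apply: (mulgI (B ^+ geo b S)); rewrite !mulgA mulgV mul1g -expgD /geo_deficit subnKC ?geo_le //.
  apply: (mulgI (C ^- S)); rewrite mulKg mulgA -expgVn.
  by rewrite -(rel_swap _ _ _ _ RB) expgVn mulgKV.
set r := (2 ^ q1 * s * e)%N.
have Sr : C ^+ S = B ^+ (S * r) * A ^+ (T * r).
  rewrite [B ^+ (S * r)]expgM [A ^+ (T * r)]expgM -expgMn // -D -expgM.
  have -> : (2 ^ l * d * r = (d * e) * S)%N.
    by rewrite /r /S hq1 expnD; ring.
  by rewrite expgM hCe.
have [g hg] : exists g, geo_deficit b S = (2 ^ (l + m).+1 * g)%N.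
  have : (2 ^ (m.-1 + (2 * m - 1)) %| geo_deficit b S)%N.
    by apply: geo_deficit_dvd; rewrite // ?prednK ?bx ?dvdn_mulr // ltnW.
  case/dvdnP=> g ->; exists (2 ^ (3 * m - 2 - (l + m).+1) * g)%N.
  by rewrite E5 [in LHS]expnD; ring.
(* A^(K-1) is A^-1 and K - 1 is odd, so parities of exponents remain visible. *)
set K := (2 * #[A])%N.
have e2 : A ^+ (2 ^ (m + l) * N + T * r * K.-1) = B ^+ (geo_deficit b S + S * r).
  have K0 : (0 < K)%N by rewrite muln_gt0 order_gt0.
  rewrite expgD e1 Sr mulgA -expgD -mulgA -expgD -mulnS prednK // /K.
  by rewrite mulnA [(_ * _ * #[A])%N]mulnC expgM expg_order expg1n mulg1.
have Tr : (T * r = 2 ^ (4 * m - 2 - l) * (t * s * e))%N.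
  by rewrite /T /r E4 expnD; ring.
have Sr' : (S * r = 2 ^ (4 * m - 2 - l) * (s * s * e))%N.
  by rewrite /S /r E4 expnD; ring.
have K1 : odd K.-1 by have := order_gt0 A; rewrite /K; case: #[A] => // n _; rewrite mulnS /= oddM.
rewrite Tr Sr' hg in e2.
(* In the strict case the exponent of A has valuation exactly l + m and that of B a larger one. In
   the case of equality the two odd contributions to the exponent of A add up to an even one, and B
   is the side of valuation exactly l + m. *)
split=> lm'.
  have [j hj] := E2 lm'.
  apply: (two_elt_odd_mem _ <[_]>%G _ (N + 2 * (2 ^ j * (t * s * e) * K.-1))).
  - exact: p_eltX.
  - by rewrite oddD oN oddM.
  rewrite -expgM; have <- : (2 ^ (m + l) * N + 2 ^ (4 * m - 2 - l) * (t * s * e) * K.-1 =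
      2 ^ (l + m) * (N + 2 * (2 ^ j * (t * s * e) * K.-1)))%N.
    by rewrite [(m + l)%N]addnC E1 hj [(2 ^ (_ + j.+1))%N]expnD expnS; ring.
  rewrite e2; have -> : (2 ^ (l + m).+1 * g + 2 ^ (4 * m - 2 - l) * (s * s * e) =
      2 ^ (l + m).+1 * (g + 2 ^ j * (s * s * e)))%N.
    by rewrite E1 hj [(2 ^ (_ + j.+1))%N]expnD !expnS; ring.
  by rewrite expgM mem_cycle.
have eE := E3 lm'.
have [q hq] : exists q, (N + t * s * e * K.-1 = 2 * q)%N.
  exists (N + t * s * e * K.-1)./2; rewrite mul2n -[LHS]odd_double_half.
  by rewrite oddD !oddM oN ot os oe K1.
apply: (two_elt_odd_mem _ <[_]>%G _ (2 * g + s * s * e)).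
- exact: p_eltX.
- by rewrite oddD !oddM os oe.
rewrite -expgM; have -> : (2 ^ (l + m) * (2 * g + s * s * e) =
    2 ^ (l + m).+1 * g + 2 ^ (4 * m - 2 - l) * (s * s * e))%N.
  by rewrite eE expnS; ring.
rewrite -e2 eE; have -> : (2 ^ (m + l) * N + 2 ^ (l + m) * (t * s * e) * K.-1 = 2 ^ (l + m).+1 * q)%N.
  rewrite [(m + l)%N]addnC -mulnA -mulnDr hq expnS; ring.
by rewrite expgM mem_cycle.
Qed.

End TwoGroup.

Lemma two_cycles_trivial (gT : finGroupType) (u v : gT) : 2.-elt u ->
  u \in <[v ^+ 2]> -> v \in <[u ^+ 2]> -> u = 1.
Proof.
move=> u2 uv vu; apply/eqP; apply/negPn/negP => u1.
have : u \in <[u ^+ 2]> by apply: (subsetP _ _ uv); rewrite cycle_subG groupX.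
have [k ok] := p_natP u2; have k0 : (0 < k)%N.
  by case: k ok => // /eqP; rewrite order_eq1 (negPf u1).
rewrite -cycle_subG => /subset_leq_card; rewrite -!orderE orderXdiv ok; last first.
  by rewrite -(prednK k0) expnS dvdn_mulr.
by rewrite leqNgt ltn_Pdiv // expn_gt0.
Qed.

(** In either case [two_half_bound] and its mirror image put each of A^(2^(l+m)) and B^(2^(l+m))
    into the subgroup generated by the square of the other, which is impossible for non-trivial
    2-elements. *)
Lemma two_rel_exponent (gT : finGroupType) (a b m l : nat) (A B C : gT) :
  two_rel gT a b m l A B C -> A ^+ (2 ^ (l + m)) = 1.
Proof.
move=> H; have [h1 h2] := two_half_bound _ _ _ _ _ _ _ _ H.
have [h3 h4] := two_half_bound _ _ _ _ _ _ _ _ (two_rel_sym _ _ _ _ _ _ _ _ H).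
case: H => _ _ _ _ lm _ _ _ _ _ _ A2 B2 _.
have eS (z : gT) : z ^+ (2 ^ (l + m).+1) = (z ^+ (2 ^ (l + m))) ^+ 2 by rewrite expnSr expgM.
rewrite !eS in h1 h2 h3 h4; move: lm; rewrite leq_eqVlt => /orP[/eqP lm|lm].
- apply: (two_cycles_trivial _ _ (B ^+ (2 ^ (l + m)))); first exact: p_eltX.
  + exact: h4.
  + exact: h2.
- apply: (two_cycles_trivial _ _ (B ^+ (2 ^ (l + m)))); first exact: p_eltX.
  + exact: h1.
  + exact: h3.
Qed.

(** * The class of the 2-group *)

Lemma expg_dvd1 (gT : finGroupType) (x : gT) (j k : nat) :
  x ^+ j = 1 -> (j %| k)%N -> x ^+ k = 1.
Proof. by move=> h /dvdnP[i ->]; rewrite mulnC expgM h expg1n. Qed.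

Lemma ucn_step (gT : finGroupType) (P : {group gT}) (A B x : gT) (n : nat) :
  P :=: <[A]> <*> <[B]> -> x \in P -> [~ x, A] \in 'Z_n(P) -> [~ x, B] \in 'Z_n(P) -> x \in 'Z_n.+1(P).
Proof.
move=> hP xP xA xB; rewrite ucnSnR inE xP /=.
have nZ : P \subset 'N('Z_n(P)) := ucn_norm n P.
have AP : A \in P by rewrite hP mem_gen // inE cycle_id.
have BP : B \in P by rewrite hP mem_gen // inE cycle_id orbT.
have [xN AN BN] : [/\ x \in 'N('Z_n(P)), A \in 'N('Z_n(P)) & B \in 'N('Z_n(P))].
  by split; apply: (subsetP nZ).
have cx g : g \in 'N('Z_n(P)) -> [~ x, g] \in 'Z_n(P) ->
    coset 'Z_n(P) x \in 'C[coset 'Z_n(P) g].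
  by move=> gN h; apply/cent1P/commgP; rewrite -morphR //= coset_id.
rewrite -quotient_cents2 ?sub1set // quotient_set1 // sub1set.
have -> : P / 'Z_n(P) = <[coset 'Z_n(P) A]> <*> <[coset 'Z_n(P) B]>.
  by rewrite -!quotient_cycle // -quotientY ?cycle_subG // -hP.
by rewrite centY inE !cent_cycle !cx.
Qed.

Lemma ucn_commgV (gT : finGroupType) (P : {group gT}) (x g : gT) (n : nat) :
  x \in P -> g \in P -> [~ x, g] \in 'Z_n(P) -> [~ x^-1, g] \in 'Z_n(P).
Proof.
move=> xP gP h; have -> : [~ x^-1, g] = ([~ x, g]^-1) ^ x^-1.
  by rewrite /commg /conjg !invMg !invgK !mulgA mulgK.
by rewrite memJ_norm ?groupV // (subsetP (normal_norm (ucn_normal n P))).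
Qed.

Section Structure.
Variables (gT : finGroupType) (a b m l : nat) (A B C : gT).
Hypothesis H : two_rel gT a b m l A B C.
Variable P : {group gT}.
Hypothesis hP : P :=: <[A]> <*> <[B]>.

Lemma tr_aP : (0 < a)%N /\ (2 ^ m %| a.-1)%N.
Proof. by case: H => a0 _ _ _ _ [x _ ->]; rewrite dvdn_mulr. Qed.

Lemma tr_memA : A \in P. Proof. by rewrite hP mem_gen // inE cycle_id. Qed.
Lemma tr_memB : B \in P. Proof. by rewrite hP mem_gen // inE cycle_id orbT. Qed.

Lemma tr_CE : C = [~ A, B].
Proof. by rewrite commgEl (tr_C _ _ _ _ _ _ _ _ H) mulKg. Qed.

Lemma tr_memC : C \in P. Proof. by rewrite tr_CE groupR ?tr_memA ?tr_memB. Qed.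

Lemma tr_Apow (k : nat) : (2 ^ (l + m) %| k)%N -> A ^+ k = 1.
Proof. exact/expg_dvd1/(two_rel_exponent _ _ _ _ _ _ _ _ H). Qed.

(** The commutator is A^(j (a^k - 1)), and its exponent is divisible by 2^(e+m+f). *)
Lemma tr_AC_comm (j k e f : nat) : (2 ^ e %| j)%N -> (2 ^ f %| k)%N -> (l <= e + f)%N ->
  commute (A ^+ j) (C ^+ k).
Proof.
move=> ej fk ef; have [a0 am] := tr_aP.
apply/commgP/conjg_fixP; rewrite (rel_conjX _ _ _ _ (tr_RA _ _ _ _ _ _ _ _ H)).
have ak : (0 < a ^ k)%N by rewrite expn_gt0 a0.
rewrite -(prednK ak) mulnS expgD [A ^+ (_ * _)]tr_Apow ?mulg1 //.
have := expn_pred_dvd m a f k (ltnW (tr_m _ _ _ _ _ _ _ _ H)) a0 am fk.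
move=> h; apply: dvdn_trans (dvdn_mul ej h); rewrite -expnD dvdn_exp2l //.
by rewrite addnCA addnC leq_add2l.
Qed.

Lemma tr_comm_key (s t k : nat) : (2 ^ l %| k)%N -> C ^+ k = B ^+ s * A ^+ t ->
  commute (B ^+ s) (A ^+ t).
Proof.
move=> lk D; have -> : B ^+ s = C ^+ k * (A ^+ t)^-1 by rewrite D mulgK.
apply: commute_sym; apply: commuteM; last exact/commuteV.
by apply: (tr_AC_comm _ _ 0 l); rewrite ?expn0 ?dvd1n.
Qed.

End Structure.

Section StructureTwo.
Variables (gT : finGroupType) (a b m l : nat) (A B C : gT).
Hypothesis H : two_rel gT a b m l A B C.
Variable P : {group gT}.
Hypothesis hP : P :=: <[A]> <*> <[B]>.
Let H' := two_rel_sym _ _ _ _ _ _ _ _ H.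

Lemma tr_Bpow (k : nat) : (2 ^ (l + m) %| k)%N -> B ^+ k = 1.
Proof. exact: tr_Apow H' k. Qed.

(** Raising [two_key] to the power 2^(l-m+1) brings the exponents of A and B from valuation 2m - 1
    to l + m, where both vanish. *)
Lemma tr_Cpow (k : nat) : (2 ^ (2 * l - m + 1) %| k)%N -> C ^+ k = 1.
Proof.
have [d [s [t [od os ot D]]]] := two_key _ _ _ _ _ _ _ _ H.
case: (H) => _ _ m1 ml lm _ _ _ _ _ _ _ _ C2; apply: expg_dvd1.
have E : (2 * l - m + 1 = l + (l - m + 1))%N by clear -ml; lia.
have E2 : (2 * m - 1 + (l - m + 1) = l + m)%N by clear -ml m1; lia.
have D2 i : (2 ^ (l + m) %| 2 ^ (2 * m - 1) * i * 2 ^ (l - m + 1))%N.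
  by rewrite mulnAC -expnD E2 dvdn_mulr.
have h : (C ^+ (2 ^ l * d)) ^+ (2 ^ (l - m + 1)) = 1.
  rewrite D expgMn; last by apply: (tr_comm_key _ _ _ _ _ _ _ _ H _ _ (2 ^ l * d)); rewrite ?dvdn_mulr.
  by rewrite -!expgM (tr_Apow _ _ _ _ _ _ _ _ H) ?tr_Bpow ?mulg1.
by apply: (two_elt_exp_odd _ _ _ d); rewrite // E expnD mulnAC expgM.
Qed.

(** The inequality 2l - m + 1 <= 2m - 1 is the hypothesis 2l + 2 <= 3m. *)
Lemma tr_Cpow2 (k : nat) : (2 ^ (2 * m - 1) %| k)%N -> C ^+ k = 1.
Proof.
case: (H) => _ _ m1 ml lm _ _ _ _ _ _ _ _ _ mk; apply: tr_Cpow.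
by apply: dvdn_trans mk; rewrite dvdn_exp2l //; clear -ml lm m1; lia.
Qed.

(** In (A^k)^B = C^k A^([geo a k]) the factor C^k is trivial, and [geo a k] differs from k by a
    multiple of 2^(3m-2), which kills A because l <= 2m - 2. *)
Lemma tr_A_central (k : nat) : (2 ^ (2 * m - 1) %| k)%N -> A ^+ k \in 'Z(P).
Proof.
case: (H) => a0 _ m1 ml lm _ _ hC RA _ _ _ _ _ mk.
have e : (A ^+ k) ^ B = A ^+ k.
  rewrite (rel_pow_conjB _ _ _ _ _ hC RA) tr_Cpow2 // mul1g.
  have [_ am] := tr_aP _ _ _ _ _ _ _ _ H.
  have [|[u ->] _] := geo_mod2 m.-1 a (2 * m - 1) k a0 _ mk; first by rewrite prednK // ltnW.
  rewrite expgD [A ^+ (_ * u)](tr_Apow _ _ _ _ _ _ _ _ H) ?mulg1 // dvdn_mulr // dvdn_exp2l //.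
  by clear -ml lm m1; lia.
rewrite inE groupX ?(tr_memA _ _ _ _ hP) //= -sub_cent1 hP join_subG !cycle_subG.
by apply/andP; split; apply/cent1P/commute_sym; [apply/commute_sym/commuteX | apply/commgP/conjg_fixP].
Qed.

End StructureTwo.

Section UpperSeries.
Variables (gT : finGroupType) (a b m l : nat) (A B C : gT).
Hypothesis H : two_rel gT a b m l A B C.
Variable P : {group gT}.
Hypothesis hP : P :=: <[A]> <*> <[B]>.

Lemma tr_CA_comm (k : nat) : [~ C ^+ k, A] = (A ^+ (a ^ k).-1)^-1.
Proof.
have [a0 RA] := (tr_a0 _ _ _ _ _ _ _ _ H, tr_RA _ _ _ _ _ _ _ _ H).
by rewrite commgEl (rel_comm_pow_conjA _ _ _ _ RA _ a0) mulKg.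
Qed.

Lemma tr_CA_Z1 (k : nat) : (2 ^ m %| k)%N -> [~ C ^+ k, A] \in 'Z_1(P).
Proof.
move=> mk; have [a0 am] := tr_aP _ _ _ _ _ _ _ _ H.
have m1 := tr_m _ _ _ _ _ _ _ _ H.
rewrite tr_CA_comm ucn1 groupV; apply: (tr_A_central _ _ _ _ _ _ _ _ H _ hP).
apply: dvdn_trans (expn_pred_dvd m a m k (ltnW m1) a0 am mk); rewrite dvdn_exp2l //.
by clear; lia.
Qed.

Lemma tr_CA_Z3 : A ^+ (2 ^ m) \in 'Z_3(P) -> [~ C, A] \in 'Z_3(P).
Proof.
move=> AZ; rewrite -{1}[C]expg1 tr_CA_comm expn1 groupV.
by have [_ /dvdnP[j ->]] := tr_aP _ _ _ _ _ _ _ _ H; rewrite mulnC expgM groupX.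
Qed.

Lemma tr_A_Z3 : C ^+ (2 ^ m) \in 'Z_2(P) -> A ^+ (2 ^ m) \in 'Z_3(P).
Proof.
move=> CZ; have AP := tr_memA _ _ _ _ hP; have [a0 am] := tr_aP _ _ _ _ _ _ _ _ H.
have m1 := tr_m _ _ _ _ _ _ _ _ H.
apply: (ucn_step _ _ _ _ _ _ hP); first by rewrite groupX.
  have -> : [~ A ^+ (2 ^ m), A] = 1 by apply/eqP/commgP/commute_sym/commuteX.
  exact: group1.
rewrite commgEl (rel_pow_conjB _ _ _ _ _ (tr_C _ _ _ _ _ _ _ _ H) (tr_RA _ _ _ _ _ _ _ _ H)).
have [|[u ->] _] := geo_mod2 m.-1 a m (2 ^ m) a0 _ (dvdnn _); first by rewrite prednK // ltnW.
rewrite expgD !mulgA -[_ * _ * A ^+ (2 ^ m)]mulgA -[_^-1 * _]conjgE groupM //.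
  by rewrite memJ_norm // (subsetP (ucn_norm 2 P)) // groupX.
apply: (subsetP (ucn_subS 1 P)); rewrite ucn1; apply: (tr_A_central _ _ _ _ _ _ _ _ H _ hP).
by rewrite dvdn_mulr // dvdn_exp2l //; clear; lia.
Qed.

End UpperSeries.

Section ClassFive.
Variables (gT : finGroupType) (a b m l : nat) (A B C : gT).
Hypothesis H : two_rel gT a b m l A B C.
Variable P : {group gT}.
Hypothesis hP : P :=: <[A]> <*> <[B]>.
Let H' := two_rel_sym _ _ _ _ _ _ _ _ H.
Let hP' : P :=: <[B]> <*> <[A]>. Proof. by rewrite joingC. Qed.
Let AP : A \in P := tr_memA _ _ _ _ hP.
Let BP : B \in P := tr_memB _ _ _ _ hP.
Let CP : C \in P := tr_memC _ _ _ _ _ _ _ _ H _ hP.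

Lemma tr_C_Z2 : C ^+ (2 ^ m) \in 'Z_2(P).
Proof.
apply: (ucn_step _ _ _ _ _ _ hP); first by rewrite groupX.
  by apply: (tr_CA_Z1 _ _ _ _ _ _ _ _ H _ hP).
rewrite -[C ^+ _]invgK -expgVn; apply: ucn_commgV; rewrite ?groupX ?groupV //.
by apply: (tr_CA_Z1 _ _ _ _ _ _ _ _ H' _ hP').
Qed.

Lemma tr_AB_Z3 : A ^+ (2 ^ m) \in 'Z_3(P) /\ B ^+ (2 ^ m) \in 'Z_3(P).
Proof.
split; first by apply: (tr_A_Z3 _ _ _ _ _ _ _ _ H _ hP tr_C_Z2).
by apply: (tr_A_Z3 _ _ _ _ _ _ _ _ H' _ hP'); rewrite expgVn groupV tr_C_Z2.
Qed.

Lemma tr_C_Z4 : C \in 'Z_4(P).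
Proof.
have [AZ BZ] := tr_AB_Z3; apply: (ucn_step _ _ _ _ _ _ hP) => //.
  by apply: (tr_CA_Z3 _ _ _ _ _ _ _ _ H).
rewrite -[C]invgK; apply: ucn_commgV; rewrite ?groupV //.
by apply: (tr_CA_Z3 _ _ _ _ _ _ _ _ H').
Qed.

Lemma tr_Z5 : 'Z_5(P) = P.
Proof.
have CE := tr_CE _ _ _ _ _ _ _ _ H.
apply/eqP; rewrite eqEsubset ucn_sub /=.
suff /andP[A5 B5] : (A \in 'Z_5(P)) && (B \in 'Z_5(P)).
  have sub : <[A]> <*> <[B]> \subset 'Z_5(P) by rewrite join_subG !cycle_subG A5.
  by apply/subsetP => g gP; apply: (subsetP sub); rewrite -hP.
apply/andP; split.
  apply: (ucn_step _ _ _ _ _ _ hP) => //; last by rewrite -CE tr_C_Z4.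
  by rewrite commgg group1.
apply: (ucn_step _ _ _ _ _ _ hP) => //; last by rewrite commgg group1.
by rewrite -invg_comm -CE groupV tr_C_Z4.
Qed.

(** For the lower bound, [[A^(a-1), B], A] lies in the fifth term of the lower central series, as
    A^(a-1) is the inverse of [C, A]. It is trivial only if A^(a^(a-1) - 1) = 1; that exponent has
    valuation 2m, and 2m <= l + m - 1. *)
Lemma tr_nil_class : A ^+ (2 ^ (l + m - 1)) != 1 -> nil_class P = 5.
Proof.
move=> A1; have nilP : nilpotent P by apply/ucnP; exists 5; exact: tr_Z5.
apply/eqP; rewrite eqn_leq; apply/andP; split.
  by apply/ucn_nil_classP => //; rewrite tr_Z5.
rewrite ltnNge; apply/negP => /(lcn_nil_classP _ nilP) L5.
have [a0 b0 m1 ml lm [x ox ax] _ hC RA _ _ A2 _ _] := H.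
have CE := tr_CE _ _ _ _ _ _ _ _ H.
have C2 : C \in 'L_2(P) by rewrite CE lcnSn mem_commg ?lcn1.
have A3 : A ^+ a.-1 \in 'L_3(P).
  have := tr_CA_comm _ _ _ _ _ _ _ _ H 1; rewrite expg1 expn1 => e.
  by rewrite lcnSn -[A ^+ _]invgK groupV -e mem_commg.
have A4 : [~ A ^+ a.-1, B] \in 'L_4(P) by rewrite lcnSn mem_commg.
have : [~ [~ A ^+ a.-1, B], A] \in 'L_5(P) by rewrite lcnSn mem_commg.
rewrite L5 => /set1P/eqP/conjg_fixP.
rewrite [[~ A ^+ _, B]]commgEl (rel_pow_conjB _ _ _ _ _ hC RA) !conjMg conjVg.
have AJ k : (A ^+ k) ^ A = A ^+ k by rewrite conjgE -expgSr expgS mulKg.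
rewrite !AJ (rel_comm_pow_conjA _ _ _ _ RA _ a0) => /mulgI.
rewrite -mulgA => /mulgI/(canRL (mulgK _)); rewrite mulgV => /eqP; rewrite invg_eq1 => /eqP.
have [N oN] := expn_pred_odd m a m x x m1 a0 ox ox ax; rewrite ax => ->.
move/(two_elt_exp_odd _ _ _ _ A2 oN) => h; case/eqP: A1; apply: expg_dvd1 h _.
by rewrite dvdn_exp2l //; clear -ml m1; lia.
Qed.

End ClassFive.

Section Commuting.
Variables (gT : finGroupType) (a b m l : nat) (A B C : gT).
Hypothesis H : two_rel gT a b m l A B C.
Variable P : {group gT}.
Hypothesis hP : P :=: <[A]> <*> <[B]>.
Let H' := two_rel_sym _ _ _ _ _ _ _ _ H.
Let hP' : P :=: <[B]> <*> <[A]>. Proof. by rewrite joingC. Qed.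

Lemma tr_B_central (k : nat) : (2 ^ (2 * m - 1) %| k)%N -> B ^+ k \in 'Z(P).
Proof. exact: (tr_A_central _ _ _ _ _ _ _ _ H' P hP'). Qed.

Lemma tr_center_comm (z g : gT) : z \in 'Z(P) -> g \in P -> commute z g.
Proof. by case/centerP => _ h /h. Qed.

(* Conjugation by B multiplies A^(2^m) by E th and E by ze, with th and ze central,
   whence a closed formula for the conjugate of A^(2^m) by B^j. *)
Lemma tr_AB_comm : commute (A ^+ (2 ^ m)) (B ^+ (2 ^ m)).
Proof.
have [AP BP CP] : [/\ A \in P, B \in P & C \in P].
  by split; [apply: tr_memA hP | apply: tr_memB hP | apply: tr_memC H _ hP].
have [a0 am] := tr_aP _ _ _ _ _ _ _ _ H; have [b0 bm] := tr_aP _ _ _ _ _ _ _ _ H'.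
have [_ _ m1 ml lm _ _ hC RA RB _ _ _ _] := H.
set X := A ^+ (2 ^ m); set E := C ^+ (2 ^ m).
have EP : E \in P by rewrite groupX.
have mm : (2 ^ (2 * m - 1) %| 2 ^ (m + m))%N by rewrite dvdn_exp2l //; clear; lia.
have [th [XB thZ thm]] : exists th, [/\ X ^ B = X * E * th, th \in 'Z(P) & th ^+ (2 ^ m) = 1].
  have [|[u hu] _] := geo_mod2 m.-1 a m (2 ^ m) a0 _ (dvdnn _); first by rewrite prednK // ltnW.
  exists (A ^+ (2 ^ (m.-1 + m) * u)); split.
  - rewrite /X (rel_pow_conjB _ _ _ _ _ hC RA) hu expgD mulgA; congr (_ * _).
    by apply: commute_sym; apply: (tr_AC_comm _ _ _ _ _ _ _ _ H _ _ m m); rewrite ?dvdnn //;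
       clear -lm m1 ml; lia.
  - apply: (tr_A_central _ _ _ _ _ _ _ _ H P hP); rewrite dvdn_mulr // dvdn_exp2l //.
    by clear; lia.
  - rewrite -expgM; apply: (tr_Apow _ _ _ _ _ _ _ _ H).
    by rewrite mulnAC dvdn_mulr // -expnD dvdn_exp2l //; clear -ml lm m1; lia.
have [ze [EB zeZ zem]] : exists ze, [/\ E ^ B = E * ze, ze \in 'Z(P) & ze ^+ (2 ^ m.-1) = 1].
  have := rel_comm_pow_conjA _ _ _ _ RB (2 ^ m) b0; rewrite expgVn -/E => h.
  have hN := expn_pred_dvd m b m (2 ^ m) (ltnW m1) b0 bm (dvdnn _).
  have zZ : B ^+ (b ^ 2 ^ m).-1 \in 'Z(P) by apply: tr_B_central; apply: dvdn_trans hN.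
  exists (B ^+ (b ^ 2 ^ m).-1); split=> //.
  - apply: invg_inj; rewrite -conjVg h invMg.
    have ce : commute (B ^+ (b ^ 2 ^ m).-1)^-1 E^-1 by apply: tr_center_comm; rewrite groupV.
    by rewrite ce.
  - rewrite -expgM; apply: (tr_Bpow _ _ _ _ _ _ _ _ H).
    apply: dvdn_trans (dvdn_mul hN (dvdnn _)); rewrite -expnD dvdn_exp2l //; clear -ml lm m1; lia.
have key j : X ^ (B ^+ j) = X * E ^+ j * th ^+ j * ze ^+ 'C(j, 2).
  elim: j => [|j IH]; first by rewrite !expg0 conjg1 !mulg1.
  have cz g k : g \in P -> commute (ze ^+ k) g by move=> gP; apply: tr_center_comm; rewrite ?groupX.
  have ct g k : g \in P -> commute (th ^+ k) g by move=> gP; apply: tr_center_comm; rewrite ?groupX.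
  have thP : th \in P by case/centerP: thZ. have zeP : ze \in P by case/centerP: zeZ.
  have thB k : (th ^+ k) ^ B = th ^+ k by apply/conjg_fixP/commgP/ct.
  have zeB k : (ze ^+ k) ^ B = ze ^+ k by apply/conjg_fixP/commgP/cz.
  rewrite expgSr conjgM IH !conjMg XB conjXg EB thB zeB expgMn; last first.
    by apply/commute_sym; rewrite -[ze]expg1; apply: cz.
  rewrite binS bin1 addnC expgD !expgS -!mulgA; congr (_ * (_ * _)).
  rewrite mulgA -[th]expg1 ct ?groupM ?groupX // expg1 -!mulgA; congr (_ * _).
  by congr (_ * _); rewrite !mulgA; congr (_ * _); apply: cz; rewrite groupX.
(* At j = 2^m every correction disappears; for [ze], killed by 2^(m-1), the reason is that C(2^m, 2)
   is divisible by 2^(m-1). *)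
apply/commgP/conjg_fixP; rewrite key thm.
have -> : E ^+ (2 ^ m) = 1.
  rewrite -expgM -expnD; apply: (tr_Cpow2 _ _ _ _ _ _ _ _ H); exact: mm.
have /dvdnP[q ->] : (2 ^ m.-1 %| 'C(2 ^ m, 2))%N.
  have := mul_bin_diag (2 ^ m) 1; rewrite bin1 -{1}(prednK (ltnW m1)) expnS -mulnA => /eqP.
  by rewrite eqn_pmul2l // => /eqP <-; rewrite dvdn_mulr.
by rewrite mulnC expgM zem expg1n !mulg1.
Qed.

End Commuting.

(** * The order of the 2-group *)

Lemma two_elt_order (gT : finGroupType) (x : gT) (k : nat) :
  x ^+ (2 ^ k.+1) = 1 -> x ^+ (2 ^ k) != 1 -> #[x] = (2 ^ k.+1)%N.
Proof.
move=> h1 h2; have : (#[x] %| 2 ^ k.+1)%N by rewrite order_dvdn h1.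
case/(dvdn_pfactor _ _ (isT : prime 2)) => j; rewrite leq_eqVlt => /orP[/eqP -> //|jk] oj.
by case/eqP: h2; apply: expg_dvd1 (expg_order x) _; rewrite oj dvdn_exp2l.
Qed.

Lemma two_elt_mem_dvd (gT : finGroupType) (x : gT) (K : {group gT}) (j i : nat) :
  2.-elt x -> x ^+ (2 ^ j) \notin K -> x ^+ i \in K -> (2 ^ j.+1 %| i)%N.
Proof.
move=> x2 nK xi; have [->|i0] := posnP i; first exact: dvdn0.
have [q cq eq] := pfactor_coprime (isT : prime 2) i0; rewrite coprime2n in cq.
have xK : x ^+ (2 ^ logn 2 i) \in K.
  by apply: (two_elt_odd_mem _ _ _ q) => //; [apply: p_eltX | rewrite -expgM mulnC -eq].
rewrite eq dvdn_mull // dvdn_exp2l // ltnNge; apply: contra nK => /subnKC <-.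
by rewrite expnD expgM groupX.
Qed.

Section Order.
Variables (gT : finGroupType) (a b m l : nat) (A B C : gT).
Hypothesis H : two_rel gT a b m l A B C.
Variable P : {group gT}.
Hypothesis hP : P :=: <[A]> <*> <[B]>.
Hypothesis nA : A ^+ (2 ^ (l + m - 1)) \notin <[B]>.
Hypothesis nB : B ^+ (2 ^ (l + m - 1)) \notin <[A]>.
Let H' := two_rel_sym _ _ _ _ _ _ _ _ H.
Let hP' : P :=: <[B]> <*> <[A]>. Proof. by rewrite joingC. Qed.
Let AP : A \in P := tr_memA _ _ _ _ hP.
Let BP : B \in P := tr_memB _ _ _ _ hP.
Let CP : C \in P := tr_memC _ _ _ _ _ _ _ _ H _ hP.

Let lm1 : ((l + m - 1).+1 = l + m)%N.
Proof. by case: (H) => _ _ m1 ml *; rewrite subn1 prednK // addn_gt0 (ltnW m1) orbT. Qed.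

Lemma tr_TI (i : nat) : A ^+ i \in <[B]> -> (2 ^ (l + m) %| i)%N.
Proof. by move=> h; rewrite -lm1; apply: two_elt_mem_dvd h => //; case: H. Qed.

Lemma tr_order_A : #[A] = (2 ^ (l + m))%N.
Proof.
rewrite -lm1; apply: two_elt_order; first by rewrite lm1 (two_rel_exponent _ _ _ _ _ _ _ _ H).
by apply: contraNneq nA => ->; apply: group1.
Qed.

Lemma tr_TI_eq (s t s' t' : nat) : B ^+ s * A ^+ t = B ^+ s' * A ^+ t' ->
  A ^+ t = A ^+ t' /\ B ^+ s = B ^+ s'.
Proof.
move=> e; have h : A ^+ t' * (A ^+ t)^-1 \in <[B]>.
  have -> : A ^+ t' * (A ^+ t)^-1 = (B ^+ s')^-1 * B ^+ s.
    by apply: (mulgI (B ^+ s')); rewrite mulKVg mulgA -e mulgK.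
  by rewrite groupM ?groupV ?mem_cycle.
have : A ^+ t' * (A ^+ t)^-1 \in <[A]> by rewrite groupM ?groupV ?mem_cycle.
case/cycleP => k hk; rewrite hk in h; have /(tr_Apow _ _ _ _ _ _ _ _ H) h1 := tr_TI k h.
rewrite h1 in hk; have eA : A ^+ t = A ^+ t'.
  by apply: (mulIg (A ^+ t)^-1); rewrite hk mulgV.
by split=> //; apply: (mulIg (A ^+ t)); rewrite e eA.
Qed.

(** Were C killed by 2^(2l-m), the 2^(l-m)-th power of [two_key] would give a trivial product of
    powers of B and A. Both factors would be trivial, yet A occurs there with exponent of valuation
    l + m - 1. *)
Lemma tr_order_C : #[C] = (2 ^ (2 * l - m + 1))%N.
Proof.
have [_ _ m1 ml lm _ _ _ _ _ _ A2 _ C2] := H.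
rewrite addn1; apply: two_elt_order; first by have := tr_Cpow _ _ _ _ _ _ _ _ H _ (dvdnn _); rewrite addn1.
apply/eqP => C1; have [d [s [t [od os ot D]]]] := two_key _ _ _ _ _ _ _ _ H.
have : (C ^+ (2 ^ l * d)) ^+ (2 ^ (l - m)) = 1.
  rewrite -expgM mulnAC -expnD; apply: expg_dvd1 C1 _; rewrite dvdn_mulr // dvdn_exp2l //.
  by clear -ml; lia.
rewrite D expgMn; last by apply: (tr_comm_key _ _ _ _ _ _ _ _ H _ _ (2 ^ l * d)); rewrite ?dvdn_mulr.
rewrite -!expgM -[1]mul1g -{1}[1](expg0 B) -[1](expg0 A) => /tr_TI_eq[].
rewrite expg0 mulnAC -expnD => h _; case/negP: nA.
have -> : (l + m - 1 = 2 * m - 1 + (l - m))%N by clear -ml m1; lia.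
by rewrite (two_elt_exp_odd _ _ _ _ A2 ot h) group1.
Qed.

End Order.

Section OrderTwo.
Variables (gT : finGroupType) (a b m l : nat) (A B C : gT).
Hypothesis H : two_rel gT a b m l A B C.
Variable P : {group gT}.
Hypothesis hP : P :=: <[A]> <*> <[B]>.
Hypothesis nA : A ^+ (2 ^ (l + m - 1)) \notin <[B]>.
Hypothesis nB : B ^+ (2 ^ (l + m - 1)) \notin <[A]>.
Let H' := two_rel_sym _ _ _ _ _ _ _ _ H.
Local Notation X := (A ^+ (2 ^ m)).
Local Notation Y := (B ^+ (2 ^ m)).

(* Comparing with two_key, such an equality forces 2^(2m-2) to divide i' = 2^m i and
   j' = 2^m j; conjugating it by A then expresses the involution of <A> as C^j',
   hence as a product of powers of A and B whose exponents are multiples of 2^(4m-3-l). *)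
Lemma tr_C_notin (i j : nat) : C ^+ (2 ^ (l - 1)) != X ^+ i * Y ^+ j.
Proof.
have oA := tr_order_A _ _ _ _ _ _ _ _ H nA.
have oB := tr_order_A _ _ _ _ _ _ _ _ H' nB; have oB' := oB.
have [d [s [t [od os ot D]]]] := two_key _ _ _ _ _ _ _ _ H.
have [a0 b0 m1 ml lm [x ox ax] [y oy bx] hC RA RB _ A2 _ C2] := H.
have hC' := rel_comm_sym _ _ _ _ hC.
apply/eqP => e; set n := (2 ^ (l - 1))%N in e.
have cXY k k' : commute (X ^+ k) (Y ^+ k').
  by apply/commute_sym/commuteX/commute_sym/commuteX; apply: tr_AB_comm H _ (erefl _).
have cn k : C ^+ (n * k) = B ^+ (2 ^ m * j * k) * A ^+ (2 ^ m * i * k).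
  by rewrite expgM e expgMn // -!expgM -!mulnA; have := cXY (i * k)%N (j * k)%N; rewrite -!expgM.
have n2 : (2 ^ l = n * 2)%N by rewrite /n -expnSr subn1 prednK //; clear -ml; lia.
have E1 : (2 * m - 1 = (2 * m - 2).+1)%N by clear -m1; lia.
have E2 : (2 ^ (2 * m - 1) %| 2 ^ (l + m))%N by rewrite dvdn_exp2l //; clear -lm m1 ml; lia.
have E3 : (l <= 2 * m - 2)%N by clear -lm m1 ml; lia.
have E4 : (2 * m - 2 = l - 1 + (2 * m - 1 - l))%N by clear -lm m1 ml; lia.
have E5 : (l + m <= 2 * m - 2 + (2 * m - 1 - l).+1)%N by clear -lm m1 ml; lia.
have E6 : (l + m <= m.-1 + (2 * m - 2))%N by clear -lm m1 ml; lia.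
have E7 : (l + m - 1 = m + (l - 1))%N by clear -ml; lia.
have cd k w : (2 ^ (2 * m - 1) * w = 2 ^ m * k * (2 * d) %[mod 2 ^ (l + m)])%N ->
    exists k0, (2 ^ m * k = 2 ^ (2 * m - 2) * k0)%N.
  move=> h; have : (2 ^ (2 * m - 1) %| 2 ^ m * k * (2 * d))%N.
    by rewrite /dvdn -(modn_dvdm _ E2) -h modn_dvdm // modnMr.
  rewrite E1 expnS mulnCA dvdn_pmul2l // Gauss_dvdl; last by rewrite coprimeXl // coprime2n.
  by case/dvdnP => k0 ->; exists k0; rewrite mulnC.
have [] := tr_TI_eq _ _ _ _ _ _ _ _ H nA _ _ _ _ (etrans (esym D) (etrans _ (cn (2 * d)%N))).
  by rewrite n2 mulnA.
move=> /eqP; rewrite eq_expg_mod_order oA => /eqP/cd[i0 hi].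
move=> /eqP; rewrite eq_expg_mod_order oB addnC [(m + l)%N]addnC => /eqP/cd[j0 hj].
set i' := (2 ^ m * i)%N in hi; set j' := (2 ^ m * j)%N in hj.
have lj : (2 ^ l %| j')%N by rewrite hj dvdn_mulr // dvdn_exp2l.
have eAB : C ^+ n = A ^+ i' * B ^+ j' by rewrite e -!expgM.
have cAC k : commute (A ^+ k) (C ^+ j').
  by apply: (tr_AC_comm _ _ _ _ _ _ _ _ H _ _ 0 l); rewrite ?expn0 ?dvd1n.
have [w ow hw] := expn_pred_odd m a (l - 1) 1 x m1 a0 ox isT ax.
rewrite muln1 -/n in hw; set N := (2 ^ (m + (l - 1)) * w)%N in hw.
have eN : A ^+ N = C ^+ j'.
  have := rel_comm_pow_conjA _ _ _ _ RA n a0; rewrite hw {1}eAB conjMg.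
  rewrite (rel_pow_conjB _ _ _ _ _ hC' RB) expgVn [(A ^+ _) ^ A]conjgE -expgSr expgS mulKg.
  have [||[u ->] _] := geo_mod2 m.-1 b (2 * m - 2) j' b0 _ _.
  - by rewrite prednK ?bx ?dvdn_mulr // ltnW.
  - by rewrite hj dvdn_mulr.
  rewrite expgD [B ^+ (_ * u)](tr_Bpow _ _ _ _ _ _ _ _ H) ?mulg1; last first.
    by rewrite dvdn_mulr // dvdn_exp2l.
  rewrite mulgA (commuteV (cAC i')) -mulgA -eAB => h.
  apply: invg_inj; apply: (mulgI (C ^+ n)); rewrite -h.
  by apply/commute_sym/commuteV/commute_sym/commuteX2.
set r := (2 ^ (2 * m - 1 - l) * j0)%N.
have ejr : (j' = n * r)%N by rewrite hj /n /r E4 expnD mulnA.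
have [] : A ^+ (i' * r) = A ^+ N /\ B ^+ (j' * r) = B ^+ 0.
  by apply: (tr_TI_eq _ _ _ _ _ _ _ _ H nA); rewrite -/i' -/j' -cn -ejr expg0 mul1g eN.
rewrite expg0 => eA eB.
have ie : (i' * r = 2 ^ (2 * m - 2 + (2 * m - 1 - l)) * (i0 * j0))%N by rewrite hi /r expnD; ring.
have je : (j' * r = 2 ^ (2 * m - 2 + (2 * m - 1 - l)) * (j0 * j0))%N by rewrite hj /r expnD; ring.
suff h : (2 ^ (l + m) %| i' * r)%N.
  case/negP: nA; rewrite (tr_Apow _ _ _ _ _ _ _ _ H _ h) in eA.
  by rewrite E7 (two_elt_exp_odd _ _ _ _ A2 ow (esym eA)) group1.
(* The valuation 4m - 3 - l can fall one short of l + m, so parity decides. For odd j0 the trivial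
   power B^(j' r) shows that there is no shortfall; for even j0 the missing factor 2 comes from i0
   j0. *)
have [oj|ej] := boolP (odd j0).
  rewrite je in eB; rewrite ie dvdn_mulr // -oB' order_dvdn; apply/eqP.
  by apply: (two_elt_exp_odd _ _ _ _ _ _ eB); [case: (H) | rewrite oddM oj].
have /dvdnP[q hq] : (2 %| j0)%N by rewrite dvdn2.
rewrite ie hq (_ : i0 * (q * 2) = 2 * (i0 * q))%N; last by ring.
by rewrite mulnA -expnSr -addnS dvdn_mulr // dvdn_exp2l.
Qed.

End OrderTwo.

Section DerivedNormal.
Variables (gT : finGroupType) (a b m l : nat) (A B C : gT).
Hypothesis H : two_rel gT a b m l A B C.
Let H' := two_rel_sym _ _ _ _ _ _ _ _ H.

Lemma tr_A_norm (N : {group gT}) : A ^+ (2 ^ m) \in N -> B ^+ (2 ^ m) \in N -> C \in N ->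
  [/\ (A ^+ (2 ^ m)) ^ A \in N, (B ^+ (2 ^ m)) ^ A \in N & C ^ A \in N].
Proof.
move=> XN YN CN.
have [a0 am] := tr_aP _ _ _ _ _ _ _ _ H; have [b0 bm] := tr_aP _ _ _ _ _ _ _ _ H'.
have [_ _ m1 ml lm _ _ hC RA RB _ _ _ _] := H.
split.
- by rewrite conjgE -expgSr expgS mulKg.
- rewrite (rel_pow_conjB _ _ _ _ _ (rel_comm_sym _ _ _ _ hC) RB).
  have [|[u ->] _] := geo_mod2 m.-1 b m (2 ^ m) b0 _ (dvdnn _); first by rewrite prednK // ltnW.
  rewrite expgVn groupM //; first by rewrite groupV groupX.
  by rewrite expgD groupM // addnC expnD -mulnA expgM groupX.
- have := rel_comm_pow_conjA _ _ _ _ RA 1 a0; rewrite expg1 expn1 => ->.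
  by case/dvdnP: am => q ->; rewrite groupM // groupV mulnC expgM groupX.
Qed.

Lemma tr_A_in_norm (N : {group gT}) :
  N :=: <[A ^+ (2 ^ m)]> <*> <[B ^+ (2 ^ m)]> <*> <[C]> -> A \in 'N(N).
Proof.
move=> hN; have [||| XN YN CN] := tr_A_norm N.
- by rewrite hN -joingA mem_gen // inE cycle_id.
- by rewrite hN (joingC <[_]>) -joingA mem_gen // inE cycle_id.
- by rewrite hN mem_gen // inE cycle_id orbT.
by rewrite inE sub_conjg {1}hN !join_subG !cycle_subG !mem_conjgV XN YN CN.
Qed.

End DerivedNormal.

Section GroupOrder.
Variables (gT : finGroupType) (a b m l : nat) (A B C : gT).
Hypothesis H : two_rel gT a b m l A B C.
Variable P : {group gT}.
Hypothesis hP : P :=: <[A]> <*> <[B]>.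
Hypothesis nA : A ^+ (2 ^ (l + m - 1)) \notin <[B]>.
Hypothesis nB : B ^+ (2 ^ (l + m - 1)) \notin <[A]>.
Let H' := two_rel_sym _ _ _ _ _ _ _ _ H.
Let hP' : P :=: <[B]> <*> <[A]>. Proof. by rewrite joingC. Qed.
Let AP : A \in P := tr_memA _ _ _ _ hP.
Let BP : B \in P := tr_memB _ _ _ _ hP.
Let CP : C \in P := tr_memC _ _ _ _ _ _ _ _ H _ hP.
Local Notation X := (A ^+ (2 ^ m)).
Local Notation Y := (B ^+ (2 ^ m)).
Local Notation K := (<[X]> <*> <[Y]>)%G.
Local Notation N := (K <*> <[C]>)%G.

Lemma tr_cent_XY : <[Y]> \subset 'C(<[X]>).
Proof. by rewrite cent_cycle cycle_subG; apply/cent1P/commute_sym; exact: tr_AB_comm H _ hP. Qed.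

Lemma tr_card_K : #|K| = (2 ^ (l + l))%N.
Proof.
have oA := tr_order_A _ _ _ _ _ _ _ _ H nA.
have oB := tr_order_A _ _ _ _ _ _ _ _ H' nB.
have dv : (2 ^ m %| 2 ^ (l + m))%N by rewrite dvdn_exp2l // leq_addl.
rewrite /= (cent_joinEr tr_cent_XY) TI_cardMg.
  have dq : (2 ^ (l + m) %/ 2 ^ m = 2 ^ l)%N by rewrite expnD mulnK ?expn_gt0.
  by rewrite -!orderE !orderXdiv ?oA ?oB // dq -expnD.
apply/trivgP/subsetP => g /setIP[/cycleP[i ->]]; rewrite -expgM => gY.
have gB : A ^+ (2 ^ m * i) \in <[B]>.
  by case/cycleP: gY => j ->; rewrite -expgM mem_cycle.
by rewrite (tr_Apow _ _ _ _ _ _ _ _ H) ?group1 // (tr_TI _ _ _ _ _ _ _ _ H nA).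
Qed.

Lemma tr_C_norm_K : <[C]> \subset 'N(K).
Proof.
have [_ _ _ _ _ _ _ hC RA RB _ _ _ _] := H.
have nX : C \in 'N(<[X]>).
  by rewrite inE -cycleJ conjXg RA -expgM mulnC expgM cycle_subG mem_cycle.
have nY : C \in 'N(<[Y]>).
  by rewrite -groupV inE -cycleJ conjXg RB -expgM mulnC expgM cycle_subG mem_cycle.
by rewrite normsY ?cycle_subG.
Qed.

(** By [two_key] and 2m - 1 >= m, an odd power of C^(2^l) lies in K, hence so does C^(2^l);
    [tr_C_notin] excludes C^(2^(l-1)). The intersection is thus <C^(2^l)>. *)
Lemma tr_card_KC : #|K :&: <[C]>| = (2 ^ (l - m + 1))%N.
Proof.
have [_ _ m1 ml lm _ _ hC RA RB _ _ _ C2] := H.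
have oC := tr_order_C _ _ _ _ _ _ _ _ H nA.
have [d [s [t [od os ot D]]]] := two_key _ _ _ _ _ _ _ _ H.
have ml1 : (2 * m - 1 = m + (m - 1))%N by clear -m1; lia.
have memX j : A ^+ (2 ^ (2 * m - 1) * j) \in K.
  by rewrite ml1 expnD -mulnA expgM groupX // mem_gen // inE cycle_id.
have memY j : B ^+ (2 ^ (2 * m - 1) * j) \in K.
  by rewrite ml1 expnD -mulnA expgM groupX // mem_gen // inE cycle_id orbT.
have CK : C ^+ (2 ^ l) \in K.
  apply: (two_elt_odd_mem _ _ _ d) => //; first exact: p_eltX.
  by rewrite -expgM D groupM.
have -> : K :&: <[C]> = <[C ^+ (2 ^ l)]>.
  apply/eqP; rewrite eqEsubset subsetI !cycle_subG CK mem_cycle !andbT.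
  apply/subsetP => g /setIP[gK /cycleP[k gk]]; rewrite gk in gK *.
  have l1 : (l = (l - 1).+1)%N by clear -ml; lia.
  have : (2 ^ l %| k)%N.
    rewrite l1; apply: (two_elt_mem_dvd _ C K) => //; apply/negP.
    rewrite /= (cent_joinEr tr_cent_XY).
    case/mulsgP => _ _ /cycleP[i ->] /cycleP[j ->] e.
    by case/eqP: (tr_C_notin _ _ _ _ _ _ _ _ H nA nB i j).
  by case/dvdnP => q ->; rewrite mulnC expgM mem_cycle.
rewrite -orderE orderXdiv oC; last by rewrite dvdn_exp2l //; clear -ml; lia.
have -> : (2 * l - m + 1 = (l - m + 1) + l)%N by clear -ml; lia.
by rewrite expnD mulnK // expn_gt0.
Qed.

Lemma tr_card_N : #|N| = (2 ^ (3 * l))%N.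
Proof.
have [_ _ m1 ml lm _ _ hC RA RB _ _ _ C2] := H.
have h := mul_cardG K <[C]>; rewrite tr_card_KC tr_card_K -orderE (tr_order_C _ _ _ _ _ _ _ _ H nA) in h.
apply/eqP; rewrite -(eqn_pmul2r (_ : 0 < 2 ^ (l - m + 1))%N) ?expn_gt0 //.
rewrite /= norm_joinEr ?tr_C_norm_K // -h -!expnD; apply/eqP; congr (_ ^ _)%N.
by clear -ml; lia.
Qed.

(** The index of N is at most 2^(2m) because P / N is abelian, generated by two elements killed by
    2^m; it is at least 2^(2m) because the kernel of [f] contains N. *)
Lemma tr_card_P (rT : finGroupType) (f : {morphism P >-> rT}) :
  f X = 1 -> f Y = 1 -> f C = 1 -> #|f @* P| = (2 ^ (2 * m))%N ->
  #|P| = (2 ^ (2 * m + 3 * l))%N.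
Proof.
move=> fX fY fC fP; have XP : X \in P by apply: groupX. have YP : Y \in P by apply: groupX.
have NP : N \subset P by rewrite !join_subG !cycle_subG XP YP CP.
have nN : P \subset 'N(N).
  have -> : (P \subset 'N(N)) = (<[A]> <*> <[B]> \subset 'N(N)) by rewrite -hP.
  rewrite join_subG !cycle_subG.
  rewrite (tr_A_in_norm _ _ _ _ _ _ _ _ H) //.
  by rewrite (tr_A_in_norm _ _ _ _ _ _ _ _ H') //= cycleV (joingC <[Y]>).
have [AN BN] : A \in 'N(N) /\ B \in 'N(N) by split; apply: (subsetP nN).
apply/eqP; rewrite eqn_leq; apply/andP; split.
  rewrite -(Lagrange NP) tr_card_N -card_quotient // addnC expnD leq_mul2l; apply/orP; right.
  have -> : P / N = <[coset N A]> <*> <[coset N B]>.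
    by rewrite -!quotient_cycle // -quotientY ?cycle_subG // -hP.
  have CN : coset N C = 1 by rewrite coset_id // mem_gen // inE cycle_id orbT.
  rewrite cent_joinEl; last first.
    rewrite cent_cycle cycle_subG; apply/cent1P/commgP; rewrite -morphR //=.
    by rewrite -(tr_CE _ _ _ _ _ _ _ _ H) CN.
  apply: leq_trans (dvdn_leq _ (dvdn_cardMg _ _)) _; first by rewrite muln_gt0 !cardG_gt0.
  rewrite mul2n -addnn expnD -!orderE leq_mul // dvdn_leq ?expn_gt0 // order_dvdn -morphX //=.
    by rewrite coset_id // -joingA mem_gen // inE cycle_id.
  by rewrite coset_id // (joingC <[_]>) -joingA mem_gen // inE cycle_id.
have kk g : g \in P -> f g = 1 -> g \in 'ker f by move=> gP e; apply/kerP.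
have kN : N \subset 'ker f by rewrite !join_subG !cycle_subG !kk.
rewrite addnC expnD -tr_card_N -fP; have := card_morphim f P; rewrite setIid => ->.
rewrite -(Lagrange (subsetIl P ('ker f))) indexgI leq_mul //.
by rewrite subset_leq_card // subsetI NP.
Qed.

End GroupOrder.

(** * A permutation model *)

Section ModelRing.
Import GRing.Theory.
Local Open Scope ring_scope.
Variable R : comNzRingType.
Variables (h h' u i c : R).
Hypotheses (u3 : 3%:R * u = 1) (h3 : 2%:R * h ^+ 3 = 0).

(* With a = 1 + 2h, 3u = 1 and 2h^3 = 0, the binomial expansion of the sum of a^t,
   1 <= t <= n, stops after the cubic term. *)
Definition gpoly (n : R) : R := n + h * (n ^+ 2 + n) + 2%:R * u * h ^+ 2 * (n ^+ 3 - n).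

Lemma gpoly_geo (a n : nat) : a%:R = 1 + 2%:R * h -> (geo a n)%:R = gpoly n%:R.
Proof.
move=> ea; elim: n => [|n IH]; first by rewrite /gpoly /=; ring.
rewrite /= natrM -[(geo a n).+1%:R]natr1 IH ea -natr1 /gpoly.
set N := n%:R : R.
have e1 : 2%:R * h ^+ 2 * (N ^+ 2 + N) = (3%:R * u) * (2%:R * h ^+ 2 * (N ^+ 2 + N)) by rewrite u3 mul1r.
transitivity (1 + 2%:R * h + N + h * (N ^+ 2 + N) + 2%:R * h * N + 2%:R * u * h ^+ 2 * (N ^+ 3 - N)
   + 2%:R * h ^+ 2 * (N ^+ 2 + N) + (2%:R * h ^+ 3) * (2%:R * u * (N ^+ 3 - N))); first by ring.
by rewrite h3 mul0r addr0 e1; ring.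
Qed.

Hypothesis i2 : i ^+ 2 + i = 2%:R * c.

(** Expansion up to degree 2 in h: each step adds an even multiple of a multiple of h, so further
    terms contain 2 h^3 = 0. Since 2 is not invertible in the intended ring, C(i + 1, 2) enters as a
    separate variable c. *)
Lemma gpoly_iter (t : nat) :
  iter t gpoly i = i + 2%:R * t%:R * h * c + 2%:R * u * h ^+ 2 * t%:R * (i ^+ 3 - i)
    + 2%:R * h ^+ 2 * 'C(t, 2)%:R * c * (2%:R * i + 1).
Proof.
elim: t => [|t IH]; first by rewrite bin0n /=; ring.
rewrite iterS IH binS bin1 natrD -natr1; set T := t%:R : R; set Q := 'C(t, 2)%:R : R.
rewrite /gpoly.
set e := T * h * c + u * h ^+ 2 * T * (i ^+ 3 - i) + h ^+ 2 * Q * c * (2%:R * i + 1).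
transitivity (i + 2%:R * e + h * (i ^+ 2 + i) + 2%:R * h * e * (2%:R * i + 1) + 4%:R * h * e ^+ 2
  + 2%:R * u * h ^+ 2 * (i ^+ 3 - i) + 4%:R * u * h ^+ 2 * e * (3%:R * i ^+ 2 + 6%:R * i * e + 4%:R * e ^+ 2 - 1)).
  by rewrite /e; ring.
have [e' eE] : exists e', e = h * e'.
  by exists (T * c + u * h * T * (i ^+ 3 - i) + h * Q * c * (2%:R * i + 1)); rewrite /e; ring.
have -> : 4%:R * h * e ^+ 2 = 0.
  by transitivity ((2%:R * h ^+ 3) * (2%:R * e' ^+ 2)); [rewrite eE; ring | rewrite h3 mul0r].
have -> : 4%:R * u * h ^+ 2 * e * (3%:R * i ^+ 2 + 6%:R * i * e + 4%:R * e ^+ 2 - 1) = 0.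
  set z := (_ - 1).
  by transitivity ((2%:R * h ^+ 3) * (2%:R * u * e' * z)); [rewrite eE; ring | rewrite h3 mul0r].
have -> : 2%:R * h * e * (2%:R * i + 1) = 2%:R * h ^+ 2 * T * c * (2%:R * i + 1)
   + (2%:R * h ^+ 3) * ((u * T * (i ^+ 3 - i) + Q * c * (2%:R * i + 1)) * (2%:R * i + 1)).
  by rewrite /e; ring.
by rewrite h3 mul0r i2 /e; ring.
Qed.

(** The second coordinate of C B = B^b C in the model. The first coordinates of the two sides differ
    by (a - b) i, which rho (a - b) = 2 h^2 converts into the extra term 2 h^2 i. *)
Lemma gpoly_rel (b : nat) : b%:R = 1 + 2%:R * h' -> 'C(b, 2)%:R = b%:R * h' ->
  2%:R * h ^+ 2 * h' = 0 -> 4%:R * h * h' = 4%:R * h ^+ 2 ->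
  gpoly ((1 + 2%:R * h) * i) + 2%:R * h ^+ 2 * i = (1 + 2%:R * h) * iter b gpoly i.
Proof.
move=> eb cb z1 z2; rewrite gpoly_iter cb eb.
have -> : 2%:R * h ^+ 2 * ((1 + 2%:R * h') * h') * c * (2%:R * i + 1) =
  (2%:R * h ^+ 2 * h') * ((1 + 2%:R * h') * c * (2%:R * i + 1)) by ring.
rewrite z1 mul0r addr0 /gpoly.
transitivity (i + 2%:R * h * i + h * (i ^+ 2 + i) + 4%:R * h ^+ 2 * i ^+ 2 + 4%:R * h ^+ 2 * i
  + 2%:R * u * h ^+ 2 * (i ^+ 3 - i)
  + (2%:R * h ^+ 3) * (2%:R * i ^+ 2 + 2%:R * u * ((3%:R + 6%:R * h + 4%:R * h ^+ 2) * i ^+ 3 - i))).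
  by ring.
rewrite h3 mul0r addr0.
transitivity (i + 2%:R * h * c + (4%:R * h * h') * c + 2%:R * u * h ^+ 2 * (i ^+ 3 - i) + 2%:R * h * i
  + 4%:R * h ^+ 2 * c + (2%:R * h ^+ 2 * h') * (4%:R * c + 2%:R * u * (1 + 2%:R * h) * (i ^+ 3 - i))
  + (2%:R * h ^+ 3) * (2%:R * u * (i ^+ 3 - i))); last by ring.
rewrite z2 z1 h3 !mul0r !addr0 i2.
have -> : 4%:R * h ^+ 2 * i ^+ 2 = 4%:R * h ^+ 2 * (i ^+ 2 + i) - 4%:R * h ^+ 2 * i by ring.
by rewrite i2; ring.
Qed.

(** The sum is the displacement of the first coordinate under B^b. It is needed only after
    multiplication by rho, or by Q / L to express congruence modulo L; either multiplier kills the
    terms that are not linear in i. *)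
Lemma gpoly_sum (k : R) (b : nat) : b%:R = 1 + 2%:R * h' -> 'C(b, 2)%:R = b%:R * h' ->
  k * (2%:R * h ^+ 2) = 0 -> k * (2%:R * h * h') = 0 ->
  k * \sum_(t < b) iter t gpoly i = k * b%:R * i.
Proof.
move=> eb cb z1 z2.
have key (n : nat) : k * \sum_(t < n) iter t gpoly i = k * n%:R * i + k * (2%:R * h) * 'C(n, 2)%:R * c.
  elim: n => [|n IH]; first by rewrite big_ord0 bin0n /=; ring.
  rewrite big_ord_recr /= mulrDr IH gpoly_iter binS bin1 natrD -natr1.
  set T := n%:R : R; set Q := 'C(n, 2)%:R : R.
  transitivity (k * T * i + k * (2%:R * h) * Q * c + k * i + k * (2%:R * h) * T * c
    + (k * (2%:R * h ^+ 2)) * (u * T * (i ^+ 3 - i) + Q * c * (2%:R * i + 1))); first by ring.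
  by rewrite z1; ring.
rewrite key cb (_ : k * (2%:R * h) * (b%:R * h') * c = (k * (2%:R * h * h')) * (b%:R * c)); last by ring.
by rewrite z2; ring.
Qed.

Lemma gpoly_add (n w : R) : h * w = 0 -> gpoly (n + w) = gpoly n + w.
Proof.
move=> hw; rewrite /gpoly.
transitivity (n + w + h * (n ^+ 2 + n) + (h * w) * (2%:R * n + w + 1) + 2%:R * u * h ^+ 2 * (n ^+ 3 - n)
  + (h * w) * (2%:R * u * h * (3%:R * n ^+ 2 + 3%:R * n * w + w ^+ 2 - 1))); first by ring.
by rewrite hw; ring.
Qed.

(** The difference v of the arguments satisfies v = - h z v; four substitutions produce the factor
    h^4. *)
Lemma gpoly_inj (n n' : R) : h ^+ 4 = 0 -> gpoly n = gpoly n' -> n = n'.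
Proof.
move=> h4 e; apply/eqP; rewrite -subr_eq0; apply/eqP; set v := n - n'.
set z := (n + n' + 1) + 2%:R * u * h * (n ^+ 2 + n * n' + n' ^+ 2 - 1).
have vz : v = - (h * z * v).
  have : gpoly n - gpoly n' = 0 by rewrite e subrr.
  move=> e0; apply/eqP; rewrite -subr_eq0 -e0 /gpoly /v /z; apply/eqP; ring.
have hk : v = (h * z) ^+ 4 * v.
  rewrite {1}vz {1}vz {1}vz {1}vz; ring.
by rewrite hk exprMn h4 !mul0r.
Qed.

End ModelRing.

(** * The action of A, B and C on the cosets of <B>, over an abstract residue ring *)

Section Model.
Import GRing.Theory.
Local Open Scope ring_scope.
Variables (R : finComNzRingType) (natrep : R -> nat) (L Q : nat).
Hypotheses (L0 : (0 < L)%N) (Q0 : (0 < Q)%N) (LQ : (L %| Q)%N).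
Hypothesis natrepK : forall z, (natrep z)%:R = z.
Hypothesis natR_eq : forall n n' : nat, n%:R = n'%:R :> R <-> n = n' %[mod Q].
Variables (a b r0 : nat) (h h' u : R).
Local Notation rho := (r0%:R : R).
Hypotheses (ea : a%:R = 1 + 2%:R * h) (eb : b%:R = 1 + 2%:R * h').
Hypotheses (u3 : 3%:R * u = 1) (h3 : 2%:R * h ^+ 3 = 0) (h4 : h ^+ 4 = 0).
Hypotheses (hw : h * (rho * L%:R) = 0) (rw : rho * (rho * L%:R) = 0).
Hypothesis (hh1 : 2%:R * h ^+ 2 * h' = 0) (hh2 : 4%:R * h * h' = 4%:R * h ^+ 2).
Hypotheses (cb : 'C(b, 2)%:R = b%:R * h') (abL : a = b %[mod L]).
Hypotheses (rho1 : rho * (2%:R * h ^+ 2) = 0) (rho2 : rho * (2%:R * h * h') = 0).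
Hypotheses (q1 : (Q %/ L)%:R * (2%:R * h ^+ 2) = 0 :> R) (q2 : (Q %/ L)%:R * (2%:R * h * h') = 0 :> R).
Hypothesis rhod : rho * (a%:R - b%:R) = 2%:R * h ^+ 2.

Lemma natR_modL (n n' : nat) : n%:R = n'%:R :> R -> n = n' %[mod L].
Proof. by move/natR_eq=> e; rewrite -(modn_dvdm n LQ) e modn_dvdm. Qed.

(* (k, i) stands for the coset <B> C^k A^i, on which A, B and C act on the right by
   (k, i + 1), (k + i, geo a i) and (k + 1, a i).  Since C^L is a product of powers
   of A and B, the pairs (k + L, i) and (k, i + rho L) name the same coset, and
   tau is the resulting parametrization. *)
Definition model_point := ('I_L * R)%type.

Definition tau (k i : nat) : model_point := (Ordinal (ltn_pmod k L0), i%:R + rho * k%:R).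

Definition tau_rep (p : model_point) : nat := natrep (p.2 - rho * (nat_of_ord p.1)%:R).

Lemma tauE (k i k' i' : nat) :
  tau k i = tau k' i' <-> k = k' %[mod L] /\ i%:R + rho * k%:R = i'%:R + rho * k'%:R.
Proof.
split=> [e|[e1 e2]].
  by split; [exact: (congr1 (fun p : model_point => val p.1) e) | exact: (congr1 snd e)].
by rewrite /tau e2; congr (_, _); apply: val_inj.
Qed.

Lemma tau_repK (p : model_point) : tau p.1 (tau_rep p) = p.
Proof.
case: p => k j; have e : (tau_rep (k, j))%:R + rho * (k : nat)%:R = j by rewrite /tau_rep natrepK subrK.
by rewrite /tau e; congr (_, _); apply: val_inj; rewrite /= modn_small ?ltn_ord.
Qed.

Lemma modL_wlog (k k' : nat) : k = k' %[mod L] ->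
  exists r, k' = (k + L * r)%N \/ k = (k' + L * r)%N.
Proof.
move=> e; have [kk'|/ltnW kk'] := leqP k k'.
  move/eqP: e; rewrite eq_sym eqn_mod_dvd // => /dvdnP[r hr].
  by exists r; left; rewrite mulnC -hr subnKC.
move/eqP: e; rewrite eqn_mod_dvd // => /dvdnP[r hr].
by exists r; right; rewrite mulnC -hr subnKC.
Qed.

Lemma geo_R (n : nat) : (geo a n)%:R = gpoly R h u n%:R.
Proof. exact: gpoly_geo. Qed.

Definition model_mapA (p : model_point) : model_point := tau p.1 (tau_rep p).+1.
Definition model_mapB (p : model_point) : model_point := tau (p.1 + tau_rep p) (geo a (tau_rep p)).

Lemma tau_shift (k i k' i' r : nat) : tau k i = tau k' i' -> k' = (k + L * r)%N ->
  i%:R = i'%:R + rho * L%:R * r%:R.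
Proof.
move=> /tauE[_ e] ek; apply: (addIr (rho * k%:R)); rewrite e ek natrD natrM; ring.
Qed.

Lemma tau_congL (i i' r : nat) : i%:R = i'%:R + rho * L%:R * r%:R :> R -> i = i' %[mod L].
Proof.
move=> e; have /natR_modL -> : i%:R = (i' + r0 * L * r)%:R :> R by rewrite natrD !natrM.
by rewrite -mulnA mulnCA mulnC addnC modnMDl.
Qed.

Lemma geo_shift (i i' r : nat) : i%:R = i'%:R + rho * L%:R * r%:R :> R ->
  (geo a i)%:R = (geo a i')%:R + rho * L%:R * r%:R :> R.
Proof. by move=> e; rewrite !geo_R e gpoly_add // mulrA hw mul0r. Qed.

Lemma geo_shift_inv (i i' r : nat) :
  (geo a i)%:R = (geo a i')%:R + rho * L%:R * r%:R :> R -> i%:R = i'%:R + rho * L%:R * r%:R :> R.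
Proof.
rewrite !geo_R -gpoly_add; last by rewrite mulrA hw mul0r.
exact: (gpoly_inj R h u).
Qed.

(** Independence of the name of a coset: i and i' differ by rho L r. [geo] carries this shift over
    unchanged since h rho L = 0, and its effect through the first coordinate vanishes since rho^2 L
    = 0. *)
Lemma tau_mapB1 (k i i' r : nat) : tau k i = tau (k + L * r) i' ->
  tau (k + i) (geo a i) = tau (k + L * r + i') (geo a i').
Proof.
move=> e; have ei := tau_shift _ _ _ _ r e (erefl _).
apply/tauE; split.
  by rewrite addnAC [(k + i' + _)%N]addnC mulnC modnMDl -modnDmr (tau_congL _ _ _ ei) modnDmr.
rewrite (geo_shift _ _ _ ei) !natrD natrM ei.
transitivity ((geo a i')%:R + rho * L%:R * r%:R + rho * (k%:R + i'%:R) + (rho * (rho * L%:R)) * r%:R); first by ring.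
by rewrite rw; ring.
Qed.

Lemma tau_mapB (k i k' i' : nat) : tau k i = tau k' i' ->
  tau (k + i) (geo a i) = tau (k' + i') (geo a i').
Proof.
move=> e; have /tauE[/modL_wlog[r [er|er]] _] := e; subst.
  exact: tau_mapB1.
by apply/esym/tau_mapB1.
Qed.

Lemma tau_mapB_inj1 (k i k' i' r : nat) : (k' + i' = k + i + L * r)%N ->
  tau (k + i) (geo a i) = tau (k' + i') (geo a i') -> tau k i = tau k' i'.
Proof.
move=> er e; have /geo_shift_inv ei := tau_shift _ _ _ _ r e er.
have eL := tau_congL _ _ _ ei.
apply/tauE; split.
  apply/eqP; rewrite -(eqn_modDr i') er [(k + i + _)%N]addnC mulnC modnMDl.
  by rewrite -modnDmr -eL modnDmr.
have ek : k'%:R = k%:R + i%:R + L%:R * r%:R - i'%:R :> R.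
  by have := congr1 (fun n => n%:R : R) er; rewrite !natrD natrM => <-; rewrite addrK.
rewrite ek ei.
transitivity (i'%:R + rho * (k%:R + (i'%:R + rho * L%:R * r%:R) + L%:R * r%:R - i'%:R)
  - (rho * (rho * L%:R)) * r%:R); first by ring.
by rewrite rw; ring.
Qed.

Lemma model_mapA_tau (k i : nat) : model_mapA (tau k i) = tau k i.+1.
Proof.
rewrite /model_mapA; have := tau_repK (tau k i); case/tauE => e1 e2; apply/tauE; split=> //.
by rewrite -!natr1 addrAC e2 addrAC.
Qed.

Lemma model_mapB_tau (k i : nat) : model_mapB (tau k i) = tau (k + i) (geo a i).
Proof. by apply: tau_mapB; rewrite tau_repK. Qed.

Lemma model_mapA_inj : injective model_mapA.
Proof.
move=> p q; rewrite -(tau_repK p) -(tau_repK q) !model_mapA_tau => /tauE[e1 e2].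
by apply/tauE; split=> //; apply: (addrI 1); rewrite !addrA !nat1r.
Qed.

Lemma model_mapB_inj : injective model_mapB.
Proof.
move=> p q; rewrite -(tau_repK p) -(tau_repK q) !model_mapB_tau => e.
have /tauE[/modL_wlog[r [er|er]] _] := e.
  exact: tau_mapB_inj1 er e.
by apply/esym/(tau_mapB_inj1 _ _ _ _ r).
Qed.

Lemma iter_geo_R (t i : nat) : (iter t (geo a) i)%:R = iter t (gpoly R h u) i%:R :> R.
Proof. by elim: t => //= t IH; rewrite geo_R IH. Qed.

Lemma iter_model_mapB (t k i : nat) :
  iter t model_mapB (tau k i) = tau (k + \sum_(j < t) iter j (geo a) i) (iter t (geo a) i).
Proof.
elim: t => [|t IH] /=; first by rewrite big_ord0 addn0.
by rewrite IH model_mapB_tau big_ord_recr /= addnA.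
Qed.

Lemma model_rel (k i : nat) :
  tau (k.+1 + a * i) (geo a (a * i)) =
  tau (k + \sum_(j < b) iter j (geo a) i).+1 (a * iter b (geo a) i).
Proof.
have [c hc] : exists c : R, i%:R ^+ 2 + i%:R = 2%:R * c.
  exists ('C(i.+1, 2)%:R); rewrite -natrM -(mul_bin_diag i.+1 1) bin1 /= natrM -natr1; ring.
have sumR : (\sum_(j < b) iter j (geo a) i)%:R = \sum_(j < b) iter j (gpoly R h u) i%:R :> R.
  by rewrite natr_sum; apply: eq_bigr => j _; rewrite iter_geo_R.
have eR := gpoly_rel R h h' u i%:R c h3 hc b eb cb hh1 hh2.
have eS (q : R) := gpoly_sum R h h' u i%:R c h3 hc q b eb cb.
apply/tauE; split.
  (* A congruence modulo L is an equality in R after multiplication by Q / L. *)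
  have eL : \sum_(j < b) iter j (geo a) i = b * i %[mod L].
    have /natR_eq : (Q %/ L * \sum_(j < b) iter j (geo a) i)%:R = (Q %/ L * (b * i))%:R :> R.
      by rewrite natrM sumR (eS _ q1 q2) !natrM mulrA.
    rewrite -{2 4}(divnK LQ) -!muln_modr => /eqP; rewrite eqn_pmul2l => [/eqP //|].
    by rewrite divn_gt0 // dvdn_leq.
  by rewrite -[(k + _).+1]addSn -modnDmr -modnMml abL modnMml -eL modnDmr.
rewrite natrM iter_geo_R ea -eR geo_R natrM ea.
rewrite -[(k + _).+1]addSn !natrD natrM !mulrDr sumR (eS rho rho1 rho2).
have -> : rho * (a%:R * i%:R) = rho * (a%:R - b%:R) * i%:R + rho * b%:R * i%:R by ring.
by rewrite rhod; ring.
Qed.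

Lemma tau_mapC (k i k' i' : nat) : tau k i = tau k' i' -> tau k.+1 (a * i) = tau k'.+1 (a * i').
Proof.
have main k0 r i0 i1 : tau k0 i0 = tau (k0 + L * r) i1 ->
    tau k0.+1 (a * i0) = tau (k0 + L * r).+1 (a * i1).
  move=> e; have ei := tau_shift _ _ _ _ r e (erefl _); apply/tauE; split.
    by rewrite -addSn addnC mulnC modnMDl.
  rewrite !natrM ea ei -addSn natrD natrM.
  transitivity ((1 + 2%:R * h) * i1%:R + rho * (k0.+1%:R + L%:R * r%:R)
    + (h * (rho * L%:R)) * (2%:R * r%:R)); first by ring.
  by rewrite hw; ring.
by move=> e; have /tauE[/modL_wlog[r [er|er]] _] := e; subst; [apply: main | apply/esym/main].
Qed.

Definition model_permA : {perm model_point} := perm model_mapA_inj.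
Definition model_permB : {perm model_point} := perm model_mapB_inj.
Local Notation model_permC := [~ model_permA, model_permB]%g.

Lemma model_permAX (n k i : nat) : (model_permA ^+ n)%g (tau k i) = tau k (i + n).
Proof.
rewrite permX; elim: n => [|n IH]; first by rewrite addn0.
by rewrite iterS IH permE model_mapA_tau addnS.
Qed.

(** Evaluating B A C = A B at the preimage of the point under B A avoids any formula for the inverse
    of B. *)
Lemma model_permC_tau (k i : nat) : model_permC (tau k i) = tau k.+1 (a * i).
Proof.
have e : (model_permB * model_permA * model_permC = model_permA * model_permB)%g.
  by rewrite -mulgA -conjg_mulR -conjgC.
set w := (model_permB * model_permA)%g^-1%g (tau k i).
have ew : (model_permB * model_permA)%g w = tau k i by rewrite permKV.
have := congr1 (fun s : {perm model_point} => s w) e; rewrite permM ew => ->.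
move: ew; rewrite -(tau_repK w) !permM !permE model_mapB_tau !model_mapA_tau model_mapB_tau => /tau_mapC <-.
by rewrite /= addnS.
Qed.

Lemma model_perm_relA : (model_permA ^ model_permC = model_permA ^+ a)%g.
Proof.
have pc := model_permC_tau; move: model_permC pc => c pc; apply: (mulgI c).
rewrite -conjgC; apply/permP => w; rewrite -(tau_repK w).
by rewrite !permM pc model_permAX permE model_mapA_tau pc mulnS addnC.
Qed.

Lemma model_perm_relB : (model_permB ^ [~ model_permB, model_permA] = model_permB ^+ b)%g.
Proof.
have pc := model_permC_tau; rewrite -invg_comm; move: model_permC pc => c pc.
rewrite conjgE invgK; apply: (mulIg c); rewrite mulgA mulgKV.
apply/permP => w; rewrite -(tau_repK w) !permM pc permX.
have -> n : iter n model_permB =1 iter n model_mapB by move=> v; apply: eq_iter => z; rewrite permE.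
by rewrite iter_model_mapB pc permE model_mapB_tau model_rel.
Qed.

Lemma model_permA_order : (model_permA ^+ Q = 1)%g.
Proof.
apply/permP => w; rewrite -(tau_repK w) model_permAX perm1; apply/tauE; split=> //; congr (_ + _).
by apply/natR_eq; rewrite modnDr.
Qed.

(** B fixes the point [tau 0 0], the coset <B> itself, while A^n moves it to [tau 0 n]. *)
Lemma model_permA_notin (n : nat) : ~~ (Q %| n)%N -> (model_permA ^+ n)%g \notin <[model_permB]>%g.
Proof.
apply: contra => /cycleP[j e].
have fix0 : (model_permB ^+ j)%g (tau 0 0) = tau 0 0.
  by rewrite permX; elim: j {e} => //= j ->; rewrite permE model_mapB_tau.
move: fix0; rewrite -e model_permAX => /tauE[_] /addIr /natR_eq.
by rewrite add0n mod0n => /eqP.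
Qed.

Lemma model_perms : exists s t : {perm model_point},
  [/\ (s ^ [~ s, t] = s ^+ a)%g, (t ^ [~ t, s] = t ^+ b)%g, (s ^+ Q = 1)%g &
      forall n : nat, ~~ (Q %| n)%N -> (s ^+ n)%g \notin <[t]>%g].
Proof.
by exists model_permA, model_permB; split;
  [exact: model_perm_relA | exact: model_perm_relB | exact: model_permA_order | exact: model_permA_notin].
Qed.

End Model.

(** * The model over Z / 2^(l+m) *)

Section ModelInstance.
Import GRing.Theory.
Local Open Scope ring_scope.

Lemma Zp_natr_eq (Q n n' : nat) : (1 < Q)%N -> n%:R = n'%:R :> 'Z_Q <-> n = n' %[mod Q].
Proof.
move=> Q1; split=> [/(congr1 val)|e]; first by rewrite /= !val_Zp_nat.
by apply: val_inj; rewrite /= !val_Zp_nat.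
Qed.

Lemma bin2_pred (m b y : nat) : (0 < m)%N -> b.-1 = (2 ^ m * y)%N ->
  'C(b, 2) = (b * (2 ^ (m - 1) * y))%N.
Proof.
move=> m0 hb; have := mul_bin_diag b 1; rewrite bin1 hb.
have -> : (2 ^ m = 2 * 2 ^ (m - 1))%N by rewrite -expnS subn1 prednK.
by move=> h; apply/eqP; rewrite -(eqn_pmul2l (isT : 0 < 2)%N) -h; apply/eqP; ring.
Qed.

(** Take L = 2^l, h = 2^(m-1) x and h' = 2^(m-1) y. Most side conditions are divisibilities by
    2^(l+m); the tightest, such as rho (2 h^2) = 0, rest on 4m - 2 - l >= l + m, which is 2l + 2 <=
    3m. *)
Lemma model_exists (m l a b x y d : nat) :
  (1 < m)%N -> (m < l)%N -> (2 * l + 2 <= 3 * m)%N -> (0 < a)%N -> (0 < b)%N ->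
  a.-1 = (2 ^ m * x)%N -> b.-1 = (2 ^ m * y)%N -> odd d ->
  a = b + 2 ^ l * d %[mod 2 ^ (l + m)] ->
  exists s t : {perm ('I_(2 ^ l) * 'Z_(2 ^ (l + m)))},
    [/\ (s ^ [~ s, t] = s ^+ a)%g, (t ^ [~ t, s] = t ^+ b)%g, (s ^+ (2 ^ (l + m)) = 1)%g
      & (s ^+ (2 ^ (l + m - 1)))%g \notin <[t]>%g].
Proof.
move=> m1 ml lm a0 b0 ax bx od ab.
have m0 : (0 < m)%N by exact: ltnW.
set L := (2 ^ l)%N; set Q := (2 ^ (l + m))%N.
have L0 : (0 < L)%N by rewrite expn_gt0.
have Q1 : (1 < Q)%N by rewrite -[X in (X < _)%N](expn0 2) ltn_exp2l // addn_gt0 m0 orbT.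
have Q0 : (0 < Q)%N by exact: ltnW.
have LQ : (L %| Q)%N by rewrite dvdn_exp2l // leq_addr.
have QL : (Q %/ L = 2 ^ m)%N by rewrite /Q expnD mulKn.
pose R : finComNzRingType := 'Z_Q.
have natR n n' : n%:R = n'%:R :> R <-> n = n' %[mod Q] by exact: Zp_natr_eq.
have zq k n : (l + m <= k)%N -> (2 ^ k * n)%:R = 0 :> R.
  move=> hk; apply/(natR _ 0%N); apply/eqP; rewrite mod0n -/(dvdn _ _).
  by rewrite dvdn_mulr // dvdn_exp2l.
have natrepK (z : R) : (nat_of_ord (z : 'Z_Q))%:R = z by exact: natr_Zp.
have [e he] : exists e, d * e = 1 %[mod Q].
  exists (d ^ (totient Q).-1)%N; rewrite -expnS prednK ?totient_gt0 //.
  by apply: Euler_exp_totient; rewrite coprimeXr // coprimen2.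
(* This solves rho (a - b) = 2 h^2, where a - b = 2^l d, 2 h^2 = 2^(2m-1) x^2 and e inverts d. *)
set r0 := (2 ^ (2 * m - 1 - l) * (x * x * e))%N.
set hn := (2 ^ (m - 1) * x)%N; set hn' := (2 ^ (m - 1) * y)%N.
have m2 : (2 ^ m = 2 * 2 ^ (m - 1))%N by rewrite -expnS subn1 prednK.
have ea : a%:R = 1 + 2%:R * hn%:R :> R.
  by rewrite -natrM nat1r -(prednK a0) ax m2 /hn mulnA.
have eb : b%:R = 1 + 2%:R * hn'%:R :> R.
  by rewrite -natrM nat1r -(prednK b0) bx m2 /hn' mulnA.
have [u u3] : exists u : R, 3%:R * u = 1.
  exists (3%:R)^-1; apply: mulrV; rewrite unitZpE // /Q coprimeXl //.
have h3 : 2%:R * hn%:R ^+ 3 = 0 :> R.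
  rewrite -natrX -natrM; have -> : (2 * hn ^ 3 = 2 ^ (1 + (m - 1) * 3) * x ^ 3)%N.
    by rewrite /hn expnMn expnD expnM; ring.
  by apply: zq; clear -m1 ml lm; lia.
have h4 : hn%:R ^+ 4 = 0 :> R.
  rewrite -natrX; have -> : (hn ^ 4 = 2 ^ ((m - 1) * 4) * x ^ 4)%N by rewrite /hn expnMn expnM; ring.
  by apply: zq; clear -m1 ml lm; lia.
have wE : (r0 * L = 2 ^ (2 * m - 1) * (x * x * e))%N.
  by rewrite /r0 /L mulnAC -expnD subnK //; clear -lm ml m1; lia.
have hw : hn%:R * (r0%:R * L%:R) = 0 :> R.
  rewrite -!natrM wE; have -> : (hn * (2 ^ (2 * m - 1) * (x * x * e)) =
      2 ^ (m - 1 + (2 * m - 1)) * (x * (x * x * e)))%N by rewrite /hn expnD; ring.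
  by apply: zq; clear -m1 ml lm; lia.
have rw : r0%:R * (r0%:R * L%:R) = 0 :> R.
  rewrite -!natrM wE; have -> : (r0 * (2 ^ (2 * m - 1) * (x * x * e)) =
      2 ^ (2 * m - 1 - l + (2 * m - 1)) * ((x * x * e) * (x * x * e)))%N by rewrite /r0 expnD; ring.
  by apply: zq; clear -m1 ml lm; lia.
have hh1 : 2%:R * hn%:R ^+ 2 * hn'%:R = 0 :> R.
  rewrite -natrX -!natrM; have -> : (2 * hn ^ 2 * hn' = 2 ^ (1 + (m - 1) * 3) * (x ^ 2 * y))%N.
    by rewrite /hn /hn' expnMn expnD expnM; ring.
  by apply: zq; clear -m1 ml lm; lia.
have abR : a%:R = b%:R + (L * d)%:R :> R by rewrite -natrD; apply/natR.
have hh2 : 4%:R * hn%:R * hn'%:R = 4%:R * hn%:R ^+ 2 :> R.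
  have z : 2%:R * hn%:R * (L * d)%:R = 0 :> R.
    rewrite -!natrM; have -> : (2 * hn * (L * d) = 2 ^ (l + m) * (x * d))%N.
      by rewrite expnD m2 /hn /L; ring.
    exact: zq.
  have e2 : 2%:R * hn'%:R = 2%:R * hn%:R - (L * d)%:R :> R.
    by apply: (addrI 1); rewrite -eb addrA -ea abR addrK.
  transitivity (2%:R * hn%:R * (2%:R * hn'%:R) : R); first by ring.
  rewrite e2 mulrBr z subr0; ring.
have cb : 'C(b, 2)%:R = b%:R * hn'%:R :> R by rewrite (bin2_pred m b y m0 bx) natrM.
have abL : a = b %[mod L].
  by rewrite -(modn_dvdm a LQ) ab modn_dvdm // /L mulnC addnC modnMDl.
have h2E : (2 * hn ^ 2 = 2 ^ (2 * m - 1) * x ^ 2)%N.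
  have -> : (2 * m - 1 = 1 + (m - 1) * 2)%N by clear -m1; lia.
  by rewrite /hn expnMn expnD expnM; ring.
have hh'E : (2 * hn * hn' = 2 ^ (2 * m - 1) * (x * y))%N.
  have -> : (2 * m - 1 = 1 + (m - 1) * 2)%N by clear -m1; lia.
  by rewrite /hn /hn' expnD expnM; ring.
have rho_z z : r0%:R * (2 ^ (2 * m - 1) * z)%:R = 0 :> R.
  rewrite -natrM; have -> : (r0 * (2 ^ (2 * m - 1) * z) =
      2 ^ (2 * m - 1 - l + (2 * m - 1)) * ((x * x * e) * z))%N by rewrite /r0 expnD; ring.
  by apply: zq; clear -m1 ml lm; lia.
have q_z z : (Q %/ L)%:R * (2 ^ (2 * m - 1) * z)%:R = 0 :> R.
  rewrite -natrM QL mulnA -expnD; apply: zq; clear -m1 ml lm; lia.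
have h2R : 2%:R * hn%:R ^+ 2 = (2 ^ (2 * m - 1) * x ^ 2)%:R :> R by rewrite -h2E natrM natrX.
have hh'R : 2%:R * hn%:R * hn'%:R = (2 ^ (2 * m - 1) * (x * y))%:R :> R by rewrite -hh'E !natrM.
have rhod : r0%:R * (a%:R - b%:R) = 2%:R * hn%:R ^+ 2 :> R.
  rewrite abR addrAC subrr add0r -natrM mulnA wE h2R; apply/natR.
  have -> : (2 ^ (2 * m - 1) * (x * x * e) * d = 2 ^ (2 * m - 1) * x ^ 2 * (d * e))%N by ring.
  by rewrite -modnMmr he modnMmr muln1.
have rho1 : r0%:R * (2%:R * hn%:R ^+ 2) = 0 :> R by rewrite h2R rho_z.
have rho2 : r0%:R * (2%:R * hn%:R * hn'%:R) = 0 :> R by rewrite hh'R rho_z.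
have q1 : (Q %/ L)%:R * (2%:R * hn%:R ^+ 2) = 0 :> R by rewrite h2R q_z.
have q2 : (Q %/ L)%:R * (2%:R * hn%:R * hn'%:R) = 0 :> R by rewrite hh'R q_z.
have [s [t [rs rt oS nst]]] := model_perms R (@nat_of_ord _) L Q L0 Q0 LQ natrepK natR a b r0
  hn%:R hn'%:R u ea eb u3 h3 h4 hw rw hh1 hh2 cb abL rho1 rho2 q1 q2 rhod.
exists s, t; split=> //; apply: nst; rewrite dvdn_Pexp2l // -ltnNge subn1 prednK //.
by rewrite addn_gt0 m0 orbT.
Qed.

End ModelInstance.

(** * From integer exponents to natural ones *)

Section Exponents.
Import GRing.Theory Num.Theory.
Local Open Scope ring_scope.

Lemma v2_modz (z : int) (n : nat) : z != 0 -> (2 ^ (v2 z).+1 %| n)%N -> (0 < n)%N ->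
  exists2 q, odd q & `|(z %% n)%Z|%N = (2 ^ v2 z * q)%N.
Proof.
move=> z0 hn n0; have az0 : (0 < `|z|)%N by rewrite absz_gt0.
have [q cq eq] := pfactor_coprime (isT : prime 2) az0; rewrite coprime2n in cq.
have e := divz_eq z n; set r := (z %% n)%Z in e *.
move: r e => r e.
have dvE D : (D %| n)%N -> (D %| `|r|)%N = (D %| `|z|)%N.
  move=> Dn; have := dvdzE D%:Z r; rewrite absz_nat => <-; have := dvdzE D%:Z z; rewrite absz_nat => <-.
  by rewrite [X in _ = (_ %| X)%Z]e rpredDl // dvdz_mull // dvdzE.
have : (2 ^ v2 z %| `|r|)%N.
  by rewrite dvE ?pfactor_dvdnn //; apply: dvdn_trans hn; rewrite dvdn_exp2l.
case/dvdnP => q' hq'; exists q'; last by rewrite hq' mulnC.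
apply/negPn/negP => nq; have : (2 ^ (v2 z).+1 %| `|r|)%N.
  by rewrite hq' expnS dvdn_mul // dvdn2.
by rewrite dvE // pfactor_dvdn // ltnn.
Qed.

Lemma dvdz_sub_nat (n u v : nat) : (n %| u%:Z - v%:Z)%Z -> u = v %[mod n].
Proof. by rewrite -eqz_mod_dvd !modz_nat => /eqP[]. Qed.

Lemma zpowg_modz (gT : finGroupType) (g : gT) (n a : nat) (z : int) : (0 < n)%N ->
  (g ^+ n = 1)%g -> (n %| (z - a%:Z)%R)%Z -> zpowg g z = (g ^+ a)%g.
Proof.
move=> n0 gn; case: z => [k|k] /= h.
  by rewrite -(expg_mod k gn) (dvdz_sub_nat _ _ _ h) expg_mod.
have : (n %| (k.+1 + a)%:Z - 0%:Z)%Z.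
  by rewrite subr0 -rpredN PoszD opprD -NegzE.
move/dvdz_sub_nat; rewrite mod0n => h'.
by apply: (mulgI (g ^+ k.+1)%g); rewrite mulgV -expgD -(expg_mod _ gn) h' expg0.
Qed.

(** The representatives are 1 plus the remainders of alpha - 1 and beta - 1 modulo n, hence
    positive. The factors 2^(m+1) and 2^(l+1) of n let the valuations survive the reduction; d comes
    from the remainder of alpha - beta, so a and b + 2^l d agree only modulo n. *)
Lemma nat_exponents (alpha beta : int) (m l n : nat) :
  alpha != 1%R -> beta != 1%R -> alpha != beta ->
  v2 (alpha - 1)%R = m -> v2 (beta - 1)%R = m -> v2 (alpha - beta)%R = l ->
  (0 < n)%N -> (2 ^ m.+1 %| n)%N -> (2 ^ l.+1 %| n)%N ->
  exists a b x y d : nat,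
    [/\ [/\ (0 < a)%N, (0 < b)%N, odd x, odd y & odd d],
        a.-1 = (2 ^ m * x)%N, b.-1 = (2 ^ m * y)%N, a = b + 2 ^ l * d %[mod n] &
        forall (gT : finGroupType) (g : gT), (g ^+ n = 1)%g ->
          zpowg g alpha = (g ^+ a)%g /\ zpowg g beta = (g ^+ b)%g].
Proof.
move=> al1 be1 ab va vb vab n0 mn ln.
have nz (z w : int) : z != w -> (z - w)%R != 0%R by rewrite subr_eq0.
have [x ox hx] := v2_modz (alpha - 1)%R n (nz _ _ al1) (eq_ind_r (fun k => 2 ^ k.+1 %| n)%N mn va) n0.
have [y oy hy] := v2_modz (beta - 1)%R n (nz _ _ be1) (eq_ind_r (fun k => 2 ^ k.+1 %| n)%N mn vb) n0.
have [d od hd] := v2_modz (alpha - beta)%R n (nz _ _ ab) (eq_ind_r (fun k => 2 ^ k.+1 %| n)%N ln vab) n0.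
rewrite va in hx; rewrite vb in hy; rewrite vab in hd.
have modE (z : int) : exists q : int, (`|(z %% n)%Z|%N%:Z = z - q * n%:Z)%R.
  exists (z %/ n)%Z; rewrite gez0_abs; last by apply: modz_ge0; case: (n) n0.
  by rewrite {2}(divz_eq z n) addrC addKr.
have [q1 e1] := modE (alpha - 1)%R; have [q2 e2] := modE (beta - 1)%R.
have [q3 e3] := modE (alpha - beta)%R.
rewrite hx in e1; rewrite hy in e2; rewrite hd in e3.
exists (1 + 2 ^ m * x)%N, (1 + 2 ^ m * y)%N, x, y, d; split=> //.
  apply: dvdz_sub_nat; rewrite !PoszD e1 e2 e3.
  by apply/dvdzP; exists (q2 + q3 - q1)%R; ring.
move=> gT g gn; split; apply: (zpowg_modz _ _ n) => //; rewrite PoszD ?e1 ?e2; apply/dvdzP.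
  by exists q1; ring.
by exists q2; ring.
Qed.

End Exponents.

(** * Passage to the Sylow 2-subgroup and conclusion *)

Lemma nilpotent_consttM (gT : finGroupType) (G : {group gT}) (pi : nat_pred) :
  nilpotent G -> {in G &, {morph (fun g => g.`_pi) : g k / g * k}}.
Proof.
move=> nilG g k gG kG /=.
have mem rho z : z \in G -> z.`_rho \in 'O_rho(G).
  move=> zG; rewrite (mem_normal_Hall (nilpotent_pcore_Hall rho nilG)) ?pcore_normal ?p_elt_constt //.
  by rewrite groupX.
have cOO : 'O_pi^'(G) \subset 'C('O_pi(G)).
  by have /dprodP[] := nilpotent_pcoreC pi nilG.
have cc u v : u \in 'O_pi^'(G) -> v \in 'O_pi(G) -> commute u v.
  by move=> uO; apply/centP/(subsetP cOO).
have mp u : u \in 'O_pi(G) -> pi.-elt u by apply: mem_p_elt; apply: pcore_pgroup.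
have mp' u : u \in 'O_pi^'(G) -> pi^'.-elt u by apply: mem_p_elt; apply: pcore_pgroup.
have e : g * k = (g.`_pi * k.`_pi) * (g.`_pi^' * k.`_pi^').
  rewrite -{1}(consttC pi g) -{1}(consttC pi k) -!mulgA; congr (_ * _); rewrite !mulgA; congr (_ * _).
  by apply: cc; apply: mem.
have m1 : g.`_pi * k.`_pi \in 'O_pi(G) by rewrite groupM ?mem.
have m2 : g.`_pi^' * k.`_pi^' \in 'O_pi^'(G) by rewrite groupM ?mem.
rewrite e consttM; last by apply/commute_sym/cc.
rewrite (constt_p_elt (mp _ m1)) (_ : (g.`_pi^' * _).`_pi = 1) ?mulg1 //.
by apply/constt1P/mp'.
Qed.

Lemma is_Galphabeta_sym (gT : finGroupType) (alpha beta : int) (G : {group gT}) (A B : gT) :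
  is_Galphabeta alpha beta G A B -> is_Galphabeta beta alpha G B A.
Proof.
case=> hG rel univ; split; first by rewrite joingC.
- by move: rel; rewrite /Grels andbC.
- move=> rT x y; rewrite /Grels andbC => r.
  by have [f [fA fB]] := univ rT y x r; exists f.
Qed.

Lemma v2_opp (z : int) : v2 (- z)%R = v2 z.
Proof. by rewrite /v2 abszN. Qed.

Section LowerBound.
Variables (alpha beta : int) (m l : nat).
Hypotheses (al1 : alpha != 1%R) (be1 : beta != 1%R) (ab : alpha != beta).
Hypotheses (va : v2 (alpha - 1)%R = m) (vb : v2 (beta - 1)%R = m) (vab : v2 (alpha - beta)%R = l).
Hypotheses (m1 : (1 < m)%N) (ml : (m < l)%N) (lm : (2 * l + 2 <= 3 * m)%N).

Let dvm n : (2 ^ m.+1 %| n * 2 ^ (l + m).+1)%N.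
Proof. by rewrite dvdn_mull // dvdn_exp2l // ltnS leq_addl. Qed.
Let dvl n : (2 ^ l.+1 %| n * 2 ^ (l + m).+1)%N.
Proof. by rewrite dvdn_mull // dvdn_exp2l // ltnS leq_addr. Qed.

(** The universal property sends A and B to the permutations s and t, and morphisms respect 2-parts.
    As s is a 2-element and the 2-part of t is a power of t, a relation in <B> would put the power
    of s into <t>. *)
Lemma Galphabeta_notin (gT : finGroupType) (G : {group gT}) (A B : gT) :
  is_Galphabeta alpha beta G A B -> A.`_2 ^+ (2 ^ (l + m - 1)) \notin <[B.`_2]>.
Proof.
case=> hG _ univ; pose rT : finGroupType := {perm ('I_(2 ^ l) * 'Z_(2 ^ (l + m)))}.
(* The order of t is not known, so the modulus is a multiple of the order of the whole permutation
   group. *)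
have [|a [b [x [y [d [[a0 b0 ox oy od] ax bx abm hz]]]]]] :=
    nat_exponents alpha beta m l (#|[set: rT]| * 2 ^ (l + m).+1) al1 be1 ab va vb vab _ (dvm _) (dvl _).
  by rewrite muln_gt0 cardG_gt0 expn_gt0.
have abM : a = b + 2 ^ l * d %[mod 2 ^ (l + m)].
  have dv : (2 ^ (l + m) %| #|[set: rT]| * 2 ^ (l + m).+1)%N by rewrite dvdn_mull // dvdn_exp2l.
  by rewrite -(modn_dvdm a dv) abm modn_dvdm.
have [s [t [rs rt os nst]]] := model_exists m l a b x y d m1 ml lm a0 b0 ax bx od abM.
have gn (g : rT) : g ^+ (#|[set: rT]| * 2 ^ (l + m).+1) = 1.
  by rewrite expgM expg_cardG ?inE // expg1n.
have [f [fA fB]] : exists f : {morphism G >-> rT}, f A = s /\ f B = t.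
  apply: univ; rewrite /Grels; have [-> _] := hz _ s (gn s); have [_ ->] := hz _ t (gn t).
  by rewrite rs rt !eqxx.
have AG : A \in G by rewrite hG mem_gen // inE cycle_id.
have BG : B \in G by rewrite hG mem_gen // inE cycle_id orbT.
have s2 : s.`_2 = s.
  by apply: constt_p_elt; rewrite /p_elt (pnat_dvd (_ : _ %| 2 ^ (l + m))%N) ?order_dvdn ?os ?pnatX.
apply: contra nst => /cycleP[j e].
have fA2 k : f (A.`_2 ^+ k) = s ^+ k by rewrite morphX ?groupX // morph_constt // fA s2.
have fB2 k : f (B.`_2 ^+ k) = t.`_2 ^+ k by rewrite morphX ?groupX // morph_constt // fB.
by rewrite -fA2 e fB2 groupX // groupX // cycle_id.
Qed.

End LowerBound.

(** The group (Z / 2^m)^2 satisfies the defining relations because alpha and beta are 1 modulo 2^m;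
    as a quotient of G it bounds the index of N from below. *)
Lemma abelian_model (m : nat) : (0 < m)%N -> exists (rT : finGroupType) (s t : rT),
  [/\ commute s t, s ^+ (2 ^ m) = 1, t ^+ (2 ^ m) = 1 & #|<[s]> <*> <[t]>| = (2 ^ (2 * m))%N].
Proof.
move=> m0; set q := (2 ^ m)%N.
have q1 : (1 < q)%N by rewrite -[X in (X < _)%N](expn0 2) ltn_exp2l.
pose rT : finGroupType := 'rV['Z_q]_2.
have cc (u v : rT) : commute u v by rewrite /commute !FinRing.zmodMgE; apply: GRing.addrC.
have ord (u : 'rV['Z_q]_2) : (u : rT) ^+ q = 1.
  rewrite FinRing.zmodXgE FinRing.zmod1gE -GRing.scaler_nat.
  by rewrite pchar_Zp // GRing.scale0r.
exists rT, (delta_mx ord0 ord0 : 'rV['Z_q]_2), (delta_mx ord0 ord_max : 'rV['Z_q]_2); split=> //.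
have -> : <[(delta_mx ord0 ord0 : 'rV['Z_q]_2) : rT]> <*> <[(delta_mx ord0 ord_max : 'rV['Z_q]_2) : rT]> = [set: rT].
  apply/eqP; rewrite eqEsubset subsetT /=; apply/subsetP => w _.
  have -> : w = ((delta_mx ord0 ord0 : 'rV['Z_q]_2) : rT) ^+ (w ord0 ord0) *
                ((delta_mx ord0 ord_max : 'rV['Z_q]_2) : rT) ^+ (w ord0 ord_max).
    rewrite FinRing.zmodMgE !FinRing.zmodXgE; apply/rowP => j.
    rewrite [RHS]mxE !mulmxnE !mxE eqxx /=.
    have [->|] : j = ord0 \/ j = ord_max.
    + by case: j => [[|[|j]]] // hj; [left | right]; apply: val_inj.
    + by rewrite eqxx /= natr_Zp GRing.mul0rn GRing.addr0.
    + by move=> ->; rewrite eqxx /= natr_Zp GRing.mul0rn GRing.add0r.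
  by rewrite groupM // groupX // mem_gen // inE cycle_id ?orbT.
by rewrite cardsT card_mx card_ord mul1n Zp_cast // -expnM mulnC.
Qed.

Theorem theorem16p5 (alpha beta : int) (m l : nat)
    (gT : finGroupType) (G : {group gT}) (A B : gT) :
  alpha != 1%R -> beta != 1%R -> alpha != beta ->
  v2 (alpha - 1)%R = m -> v2 (beta - 1)%R = m -> (3 <= m)%N ->
  v2 (alpha - beta)%R = l ->
  (m < l)%N -> (l < 2 * m)%N -> (l <= 2 * m - 3)%N -> (2 * l + 2 <= 3 * m)%N ->
  is_Galphabeta alpha beta G A B ->
  forall P : {group gT}, P \in 'Syl_2(G) ->
    [/\ #|P| = (2 ^ (2 * m + 3 * l))%N,
        nil_class P = 5%N,
        #[A.`_2] = (2 ^ (l + m))%N,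
        #[B.`_2] = (2 ^ (l + m))%N &
        #[([~ A, B]).`_2] = (2 ^ (2 * l - m + 1))%N].
Proof.
move=> al1 be1 ab va vb m3 vab ml _ _ lm gal P sylP.
have m1 : (1 < m)%N by apply: leq_trans m3.
have nA := Galphabeta_notin alpha beta m l al1 be1 ab va vb vab m1 ml lm gT G A B gal.
have vba : v2 (beta - alpha)%R = l by rewrite -vab -v2_opp GRing.opprB.
have ba : beta != alpha by rewrite eq_sym.
have nB := Galphabeta_notin beta alpha m l be1 al1 ba vb va vba m1 ml lm gT G B A
  (is_Galphabeta_sym _ _ _ _ _ _ gal).
case: gal => hG rel univ.
(* One modulus serves both purposes: it kills G, where the relations are read, and the abelian
   model, which has exponent dividing 2^m. *)
set n := (#|G| * 2 ^ (l + m).+1)%N.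
have n0 : (0 < n)%N by rewrite muln_gt0 cardG_gt0 expn_gt0.
have dvn k : (k <= (l + m).+1)%N -> (2 ^ k %| n)%N by move=> h; rewrite dvdn_mull // dvdn_exp2l.
have [a [b [x [y [d [[a0 b0 ox oy od] ax bx abn hz]]]]]] :=
    nat_exponents alpha beta m l n al1 be1 ab va vb vab n0 (dvn m.+1 (leq_addl l m)) (dvn l.+1 (leq_addr m l)).
have AG : A \in G by rewrite hG mem_gen // inE cycle_id.
have BG : B \in G by rewrite hG mem_gen // inE cycle_id orbT.
have gn (g : gT) : g \in G -> g ^+ n = 1 by move=> gG; rewrite expgM expg_cardG // expg1n.
move: rel; rewrite /Grels -(invg_comm A B); set C := [~ A, B].
have [-> _] := hz _ A (gn A AG); have [_ ->] := hz _ B (gn B BG).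
case/andP=> /eqP RA /eqP RB; have hC : A ^ B = A * C by rewrite conjg_mulR.
have CG : C \in G by rewrite groupR.
have d4 z : (4 %| 2 ^ m * z)%N by rewrite dvdn_mulr // (@dvdn_exp2l 2 2).
have nilG : nilpotent G.
  by apply: (rel_nilpotent _ a b G A B C) => //; rewrite ?ax ?bx ?d4.
have hallP : 2.-Hall(G) P by rewrite inE in sylP.
have defP : P :=: 'O_2(G) := nilpotent_Hall_pcore nilG hallP.
(* Taking 2-parts is the canonical projection of the nilpotent group G onto P, so P inherits
   generators and relations. *)
pose phi := Morphism (nilpotent_consttM _ _ 2 nilG).
have phiG : phi @* G = P.
  apply/eqP; rewrite eqEsubset; apply/andP; split; apply/subsetP => g.
    case/morphimP => k kG _ ->; rewrite defP.
    rewrite (mem_normal_Hall (nilpotent_pcore_Hall 2 nilG)) ?pcore_normal ?groupX //.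
    exact: p_elt_constt.
  move=> gP; have gG : g \in G by apply: (subsetP (pHall_sub hallP)).
  apply/morphimP; exists g => //=; apply/esym/constt_p_elt.
  exact: mem_p_elt (pHall_pgroup hallP) gP.
have hP : P :=: <[A.`_2]> <*> <[B.`_2]>.
  by rewrite -phiG [X in phi @* X]hG morphimY ?cycle_subG // !morphim_cycle.
have two k : 2.-elt (k : gT).`_2 by apply: p_elt_constt.
have H : two_rel gT a b m l A.`_2 B.`_2 C.`_2.
  split=> //; try by [exists x | exists y].
  - by have := congr1 phi hC; rewrite morphJ // morphM.
  - by have := congr1 phi RA; rewrite morphJ // morphX.
  - by have := congr1 phi RB; rewrite morphJ ?groupV // morphV // morphX.
  - exists d => //; rewrite -(expg_mod a (_ : C.`_2 ^+ n = 1)) ?abn ?expg_mod //;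
      by rewrite gn ?groupX.
have [rT [s [t [cst os ot cardst]]]] := abelian_model m (ltnW m1).
have [f [fA fB]] : exists f : {morphism G >-> rT}, f A = s /\ f B = t.
  have un (u : rT) : u ^+ (2 ^ m) = 1 -> u ^+ n = 1.
    by move=> ou; apply: expg_dvd1 ou (dvn m _); rewrite ltnW // ltnS leq_addl.
  have ua (u : rT) : u ^+ (2 ^ m) = 1 -> u ^+ a = u /\ u ^+ b = u.
    move=> ou; rewrite -(prednK a0) -(prednK b0) ax bx !expgS !expgM ou.
    by rewrite !expg1n !mulg1.
  apply: univ; rewrite /Grels; have [-> _] := hz _ s (un _ os); have [_ ->] := hz _ t (un _ ot).
  have [-> _] := ua _ os; have [_ ->] := ua _ ot.
  have -> : [~ s, t] = 1 by apply/eqP/commgP.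
  by have -> : [~ t, s] = 1 by [apply/eqP/commgP/commute_sym]; rewrite !conjg1 !eqxx.
have PG : P \subset G := pHall_sub hallP.
pose g := [morphism of restrm PG f]; have gE z : g z = f z by [].
have s2 (u : rT) : u ^+ (2 ^ m) = 1 -> u.`_2 = u.
  move=> ou; apply: constt_p_elt; rewrite /p_elt (pnat_dvd (_ : _ %| 2 ^ m)%N) ?pnatX //.
  by rewrite order_dvdn ou.
have [A2P B2P C2P] : [/\ A.`_2 \in P, B.`_2 \in P & C.`_2 \in P].
  by split; rewrite -phiG; apply/morphimP; [exists A | exists B | exists C].
have gA : g A.`_2 = s by rewrite gE morph_constt // fA s2.
have gB : g B.`_2 = t by rewrite gE morph_constt // fB s2.
have gC : g C.`_2 = 1.
  rewrite gE morph_constt // morphR // fA fB.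
  by have -> : [~ s, t] = 1; [apply/eqP/commgP | rewrite constt1].
have cP : #|P| = (2 ^ (2 * m + 3 * l))%N.
  apply: (tr_card_P _ _ _ _ _ _ _ _ H _ hP nA nB _ g).
  - by rewrite morphX // gA.
  - by rewrite morphX // gB.
  - by [].
  - by rewrite [X in g @* X]hP morphimY ?cycle_subG // !morphim_cycle // gA gB.
split=> //.
- by apply: (tr_nil_class _ _ _ _ _ _ _ _ H _ hP); apply: contraNneq nA => ->; apply: group1.
- exact: tr_order_A H nA.
- exact: tr_order_A (two_rel_sym _ _ _ _ _ _ _ _ H) nB.
- exact: tr_order_C H nA.
Qed.
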